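(* Let $A$ and $B$ be simplicial sets and let $X\to A\times B$ and $Y\to A\times B$ be bifibrations. Then a map $f\colon X\to Y$ in $(\mathrm{Set}_\Delta)_{/(A\times B)}$ is a bivariant equivalence if and only if it is a pointwise weak homotopy equivalence, i.e. for every pair of vertices $a\in A$, $b\in B$ the induced map of fibers $X_{(a,b)}\to Y_{(a,b)}$ is a weak homotopy equivalence.
   Context: A map $(p,q)\colon X\to A\times B$ of simplicial sets is a bifibration if: (1) it is an inner fibration; (2) for every $n\geq 1$ it has diagonal fillers for every lifting problem against $\Lambda^n_0\subseteq\Delta^n$ whose bottom map $f\colon\Delta^n\to A\times B$ has $\pi_B f|\Delta^{\{0,1\}}$ degenerate in $B$; (3) for every $n\geq 1$ it has diagonal fillers for every lifting problem against $\Lambda^n_n\subseteq\Delta^n$ whose bottom map $f$ has $\pi_A f|\Delta^{\{n-1,n\}}$ degenerate in $A$. For objects $M,X$ of $(\mathrm{Set}_\Delta)_{/(A\times B)}$, $\mathrm{map}_{A\times B}(M,X)$ is the fiber of $X^M\to(A\times B)^M$ over the structure map $M\to A\times B$; it is a Kan complex when $X\to A\times B$ is a bifibration. A map $Y\to Z$ in $(\mathrm{Set}_\Delta)_{/(A\times B)}$ is a bivariant equivalence if $\mathrm{map}_{A\times B}(Z,X)\to\mathrm{map}_{A\times B}(Y,X)$ is a homotopy equivalence for every bifibration $X\to A\times B$. *)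

(* Defs.v *)
From Stdlib Require Import Relations.
From HB Require Import structures.
From mathcomp Require Import all_boot.
From mathcomp Require Import boolp.

Set Implicit Arguments.
Unset Strict Implicit.
Unset Printing Implicit Defensive.

(* [mono m n] is the set of morphisms [m] -> [n] of the simplex category; the
   ordinal [n] = {0 < ... < n} is the type 'I_n.+1.  Being a subtype of a type
   of finite functions, it has extensional equality. *)
Record mono (m n : nat) := Mono {
  mono_fun :> {ffun 'I_m.+1 -> 'I_n.+1};
  monoP : [forall i : 'I_m.+1, forall j : 'I_m.+1,
    (i <= j) ==> (mono_fun i <= mono_fun j)] }.

HB.instance Definition _ m n := [isSub for @mono_fun m n].

Lemma mono_leq m n (a : mono m n) (i j : 'I_m.+1) : i <= j -> a i <= a j.
Proof. by move: (monoP a) => /forallP/(_ i)/forallP/(_ j)/implyP; apply. Qed.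

Lemma mono_eq m n (a b : mono m n) : a =1 b -> a = b.
Proof. by move=> ab; apply/val_inj/ffunP. Qed.

Lemma mk_monoP m n (a : 'I_m.+1 -> 'I_n.+1) :
  (forall i j : 'I_m.+1, i <= j -> a i <= a j) ->
  [forall i : 'I_m.+1, forall j : 'I_m.+1,
    (i <= j) ==> ([ffun k => a k] i <= [ffun k => a k] j)].
Proof.
by move=> h; do 2 apply/forallP => ?; apply/implyP => ?; rewrite !ffunE h.
Qed.

Definition mk_mono m n (a : 'I_m.+1 -> 'I_n.+1)
    (h : forall i j : 'I_m.+1, i <= j -> a i <= a j) : mono m n :=
  Mono (mk_monoP h).

Definition mono_id n : mono n n := @mk_mono n n id (fun _ _ h => h).

Definition mono_comp l m n (b : mono m n) (a : mono l m) : mono l n :=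
  @mk_mono l n (fun i => b (a i)) (fun i j h => mono_leq b (mono_leq a h)).

Definition mono_cst m n (i : 'I_n.+1) : mono m n :=
  @mk_mono m n (fun _ => i) (fun _ _ _ => leqnn i).

Definition mono_to0 n : mono n 0 := mono_cst n ord0.

Lemma mono_comp1 m n (a : mono m n) : mono_comp a (mono_id m) = a.
Proof. by apply: mono_eq => i; rewrite !ffunE. Qed.

Lemma mono_1comp m n (a : mono m n) : mono_comp (mono_id n) a = a.
Proof. by apply: mono_eq => i; rewrite !ffunE. Qed.

Lemma mono_compA k l m n (c : mono m n) (b : mono l m) (a : mono k l) :
  mono_comp c (mono_comp b a) = mono_comp (mono_comp c b) a.
Proof. by apply: mono_eq => i; rewrite !ffunE. Qed.

Lemma mono_to0_comp m n (a : mono m n) :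
  mono_comp (mono_to0 n) a = mono_to0 m.
Proof. by apply: mono_eq => i; rewrite !ffunE. Qed.

Lemma spine_subproof n (i : 'I_n) (k l : 'I_2) :
  k <= l -> (inord (i + k) : 'I_n.+1) <= (inord (i + l) : 'I_n.+1).
Proof.
have bnd (j : 'I_2) : i + j < n.+1.
  by rewrite ltnS (leq_trans _ (ltn_ord i)) // -[i.+1]addn1 leq_add2l -ltnS.
by move=> kl; rewrite !inordK // leq_add2l.
Qed.

(* The edge Delta^{i, i+1} of Delta^n, for i < n. *)
Definition spine n (i : 'I_n) : mono 1 n :=
  @mk_mono 1 n (fun k => inord (i + k)) (@spine_subproof n i).

Record sset := SSet {
  simplex :> nat -> Type;
  pull : forall m n, mono m n -> simplex n -> simplex m;
  pull_id : forall n (x : simplex n), pull (mono_id n) x = x;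
  pull_comp : forall l m n (b : mono m n) (a : mono l m) (x : simplex n),
    pull (mono_comp b a) x = pull a (pull b x) }.

Record smap (X Y : sset) := SMap {
  smap_fun :> forall n, X n -> Y n;
  smap_nat : forall m n (a : mono m n) (x : X n),
    smap_fun (pull a x) = pull a (smap_fun x) }.

Lemma smap_eq (X Y : sset) (f g : smap X Y) :
  (forall n (x : X n), f n x = g n x) -> f = g.
Proof.
case: f g => [f fP] [g gP] /= fg.
have {}fg : f = g.
  by apply: functional_extensionality_dep => n; apply: funext => x; apply: fg.
by case: _ / fg gP => gP; congr SMap; apply: Prop_irrelevance.
Qed.

Lemma scomp_nat (X Y Z : sset) (g : smap Y Z) (f : smap X Y)
  m n (a : mono m n) (x : X n) :
  g m (f m (pull a x)) = pull a (g n (f n x)).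
Proof. by rewrite !smap_nat. Qed.

Definition sid (X : sset) : smap X X :=
  @SMap X X (fun n x => x) (fun _ _ _ _ => erefl).

Definition scomp (X Y Z : sset) (g : smap Y Z) (f : smap X Y) : smap X Z :=
  SMap (scomp_nat g f).

Definition Delta (n : nat) : sset :=
  @SSet (fun m => mono m n) (fun _ _ a b => mono_comp b a)
    (fun _ b => mono_comp1 b) (fun _ _ _ b a c => mono_compA c b a).

Lemma Delta_map_nat m n (a : mono m n) k l (c : mono k l) (x : Delta m l) :
  (mono_comp a (pull c x) : Delta n k) = pull c (mono_comp a x : Delta n l).
Proof. exact: mono_compA. Qed.

Definition Delta_map m n (a : mono m n) : smap (Delta m) (Delta n) :=
  SMap (Delta_map_nat a).

Section Product.
Variables X Y : sset.

Definition sprod_pull m n (a : mono m n) (x : X n * Y n) : X m * Y m :=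
  (pull a x.1, pull a x.2).

Lemma sprod_pull_id n (x : X n * Y n) : sprod_pull (mono_id n) x = x.
Proof. by case: x => x y; rewrite /sprod_pull !pull_id. Qed.

Lemma sprod_pull_comp l m n (b : mono m n) (a : mono l m) (x : X n * Y n) :
  sprod_pull (mono_comp b a) x = sprod_pull a (sprod_pull b x).
Proof. by rewrite /sprod_pull !pull_comp. Qed.

Definition sprod : sset := SSet sprod_pull_id sprod_pull_comp.

Definition sfst : smap sprod X :=
  @SMap sprod X (fun n x => x.1) (fun _ _ _ _ => erefl).
Definition ssnd : smap sprod Y :=
  @SMap sprod Y (fun n x => x.2) (fun _ _ _ _ => erefl).
End Product.

Section ProductMap.
Variables (X X' Y Y' : sset) (f : smap X X') (g : smap Y Y').

Lemma sprod_map_nat m n (a : mono m n) (x : sprod X Y n) :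
  ((f m (pull a x).1, g m (pull a x).2) : sprod X' Y' m) =
  pull a ((f n x.1, g n x.2) : sprod X' Y' n).
Proof. by rewrite /= /sprod_pull /= !smap_nat. Qed.

Definition sprod_map : smap (sprod X Y) (sprod X' Y') := SMap sprod_map_nat.
End ProductMap.

Lemma sig_eq (T : Type) (P : T -> Prop) (x y : {x : T | P x}) :
  sval x = sval y -> x = y.
Proof. by case: x y => [x Px] [y Py] /= xy; apply: eq_exist. Qed.

Section SubObject.
Variables (X : sset) (P : forall n, X n -> Prop).
Hypothesis Pcl : forall m n (a : mono m n) (x : X n), P x -> P (pull a x).

Definition ssub_pull m n (a : mono m n) (x : {x : X n | P x}) :
    {x : X m | P x} :=
  exist _ (pull a (sval x)) (Pcl a (svalP x)).

Lemma ssub_pull_id n (x : {x : X n | P x}) : ssub_pull (mono_id n) x = x.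
Proof. by apply: sig_eq; rewrite /= pull_id. Qed.

Lemma ssub_pull_comp l m n (b : mono m n) (a : mono l m) (x : {x : X n | P x}) :
  ssub_pull (mono_comp b a) x = ssub_pull a (ssub_pull b x).
Proof. by apply: sig_eq; rewrite /= pull_comp. Qed.

Definition ssub : sset := SSet ssub_pull_id ssub_pull_comp.

Definition ssub_incl : smap ssub X :=
  @SMap ssub X (fun n x => sval x) (fun _ _ _ _ => erefl).
End SubObject.

(* Lambda^n_i is the union of the faces of Delta^n opposite to the vertices
   j <> i; a simplex lies in the face opposite to j when it misses j. *)
Definition in_horn n (i : 'I_n.+1) m (a : Delta n m) : Prop :=
  exists2 j : 'I_n.+1, j != i & forall k, a k != j.

Lemma in_horn_pull n (i : 'I_n.+1) l m (b : mono l m) (a : Delta n m) :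
  in_horn i a -> in_horn i (pull b a).
Proof. by case=> j ji aj; exists j => // k; rewrite ffunE. Qed.

Definition horn n (i : 'I_n.+1) : sset := ssub (@in_horn_pull n i).

Definition horn_incl n (i : 'I_n.+1) : smap (horn i) (Delta n) :=
  ssub_incl (@in_horn_pull n i).

Section Exponential.
Variables M X : sset.

Definition sexp_pull m n (a : mono m n) (h : smap (sprod (Delta n) M) X) :
    smap (sprod (Delta m) M) X :=
  scomp h (sprod_map (Delta_map a) (sid M)).

Lemma sexp_pull_id n (h : smap (sprod (Delta n) M) X) :
  sexp_pull (mono_id n) h = h.
Proof. by apply: smap_eq => k [x y] /=; rewrite mono_1comp. Qed.

Lemma sexp_pull_comp l m n (b : mono m n) (a : mono l m)
    (h : smap (sprod (Delta n) M) X) :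
  sexp_pull (mono_comp b a) h = sexp_pull a (sexp_pull b h).
Proof. by apply: smap_eq => k [x y] /=; rewrite mono_compA. Qed.

(* X^M *)
Definition sexp : sset := SSet sexp_pull_id sexp_pull_comp.

(* The vertex of X^M corresponding to a map M -> X. *)
Definition name (f : smap M X) : sexp 0 := scomp f (ssnd (Delta 0) M).
End Exponential.

Lemma sexp_post_nat (M X Y : sset) (p : smap X Y) m n (a : mono m n)
    (h : sexp M X n) :
  (scomp p (pull a h) : sexp M Y m) = pull a (scomp p h : sexp M Y n).
Proof. exact: smap_eq. Qed.

(* X^M -> Y^M *)
Definition sexp_post (M X Y : sset) (p : smap X Y) :
    smap (sexp M X) (sexp M Y) :=
  SMap (@sexp_post_nat M X Y p).

Lemma sexp_pre_nat (M N X : sset) (f : smap M N) m n (a : mono m n)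
    (h : sexp N X n) :
  (scomp (pull a h) (sprod_map (sid (Delta m)) f) : sexp M X m) =
  pull a (scomp h (sprod_map (sid (Delta n)) f) : sexp M X n).
Proof. exact: smap_eq. Qed.

(* X^N -> X^M *)
Definition sexp_pre (M N X : sset) (f : smap M N) :
    smap (sexp N X) (sexp M X) :=
  SMap (@sexp_pre_nat M N X f).

Section Fiber.
Variables (E S : sset) (p : smap E S) (s : S 0).

Definition in_fiber n (e : E n) : Prop := p n e = pull (mono_to0 n) s.

Lemma in_fiber_pull m n (a : mono m n) (e : E n) :
  in_fiber e -> in_fiber (pull a e).
Proof.
by rewrite /in_fiber smap_nat => ->; rewrite -pull_comp mono_to0_comp.
Qed.

Definition fiber : sset := ssub in_fiber_pull.
End Fiber.

Section FiberMap.
Variables (E S E' S' : sset) (p : smap E S) (p' : smap E' S').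
Variables (s : S 0) (s' : S' 0) (u : smap E E') (v : smap S S').
Hypotheses (sq : scomp p' u = scomp v p) (vs : v 0 s = s').

Lemma fiber_map_subproof n (e : fiber p s n) : in_fiber p' s' (u n (sval e)).
Proof.
case: e => e /= pe; rewrite /in_fiber.
have -> : p' n (u n e) = v n (p n e).
  exact: (congr1 (fun h : smap E S' => h n e) sq).
by rewrite pe smap_nat vs.
Qed.

Lemma fiber_map_nat m n (a : mono m n) (e : fiber p s n) :
  (exist _ _ (fiber_map_subproof (pull a e)) : fiber p' s' m) =
  pull a (exist _ _ (fiber_map_subproof e) : fiber p' s' n).
Proof. by apply: sig_eq; rewrite /= smap_nat. Qed.

Definition fiber_map : smap (fiber p s) (fiber p' s') := SMap fiber_map_nat.
End FiberMap.

(* The vertices of an edge e are its restrictions to Delta^{0} and Delta^{1}. *)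
Definition vertex n (i : 'I_n.+1) : mono 0 n := mono_cst 0 i.

(* Joined by a zigzag of edges: pi_0 X is the quotient of X 0 by [connected]. *)
Definition connected (X : sset) : relation (X 0) :=
  clos_refl_sym_trans (X 0) (fun x y => exists e : X 1,
    pull (vertex ord0) e = x /\ pull (vertex ord_max) e = y).

Definition pi0_bijective (X Y : sset) (f : smap X Y) : Prop :=
  (forall x x' : X 0, connected (f 0 x) (f 0 x') -> connected x x') /\
  (forall y : Y 0, exists x : X 0, connected (f 0 x) y).

(* Maps are homotopic when they lie in the same component of Y^X; when Y^X is a
   Kan complex (e.g. when Y is one) a single simplicial homotopy suffices. *)
Definition homotopic (X Y : sset) (f g : smap X Y) : Prop :=
  connected (name f) (name g).

Definition homotopy_equivalence (X Y : sset) (f : smap X Y) : Prop :=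
  exists g : smap Y X,
    homotopic (scomp g f) (sid X) /\ homotopic (scomp f g) (sid Y).

Definition kan_complex (K : sset) : Prop :=
  forall n (i : 'I_n.+2) (u : smap (horn i) K),
    exists d : smap (Delta n.+1) K, scomp d (horn_incl i) = u.

(* The usual definition for arbitrary simplicial sets: f induces a bijection
   pi_0 (K^Y) -> pi_0 (K^X) for every Kan complex K. *)
Definition weak_homotopy_equivalence (X Y : sset) (f : smap X Y) : Prop :=
  forall K : sset, kan_complex K -> pi0_bijective (sexp_pre K f).

Definition lifting_problem (X S : sset) (p : smap X S) n (i : 'I_n.+1)
    (u : smap (horn i) X) (f : smap (Delta n) S) : Prop :=
  scomp p u = scomp f (horn_incl i).

Definition has_diagonal_filler (X S : sset) (p : smap X S) n (i : 'I_n.+1)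
    (u : smap (horn i) X) (f : smap (Delta n) S) : Prop :=
  exists d : smap (Delta n) X, scomp d (horn_incl i) = u /\ scomp p d = f.

Definition inner_fibration (X S : sset) (p : smap X S) : Prop :=
  forall n (i : 'I_n.+1) (u : smap (horn i) X) (f : smap (Delta n) S),
    0 < i < n -> lifting_problem p u f -> has_diagonal_filler p u f.

Definition degenerate_edge (X : sset) (e : X 1) : Prop :=
  exists x : X 0, e = pull (mono_to0 1) x.

(* The restriction of f : Delta^n -> S to Delta^{i, i+1}, as an edge of S. *)
Definition edge_of (S : sset) n (f : smap (Delta n) S) (i : 'I_n) : S 1 :=
  f 1 (spine i).

(* The condition n >= 1 is expressed by using the simplices Delta^{n+1}. *)
Record bifibration (X A B : sset) (p : smap X (sprod A B)) : Prop := {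
  bifib_inner : inner_fibration p;
  bifib_left : forall n (u : smap (horn (ord0 : 'I_n.+2)) X)
      (f : smap (Delta n.+1) (sprod A B)),
    lifting_problem p u f ->
    degenerate_edge (edge_of (scomp (ssnd A B) f) ord0) ->
    has_diagonal_filler p u f;
  bifib_right : forall n (u : smap (horn (ord_max : 'I_n.+2)) X)
      (f : smap (Delta n.+1) (sprod A B)),
    lifting_problem p u f ->
    degenerate_edge (edge_of (scomp (sfst A B) f) ord_max) ->
    has_diagonal_filler p u f }.

(* Objects and morphisms of the slice category over S. *)
Record over (S : sset) := Over { total :> sset; str : smap total S }.

Record over_map (S : sset) (Y Z : over S) := OverMap {
  over_fun :> smap Y Z;
  over_comm : scomp (str Z) over_fun = str Y }.

(* map_S(M, X): the fiber of X^M -> S^M over the structure map of M. *)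
Definition map_over (S : sset) (M X : over S) : sset :=
  fiber (sexp_post M (str X)) (name (str M)).

Section Precomposition.
Variables (S : sset) (Y Z : over S) (f : over_map Y Z) (X : over S).

Lemma map_over_pre_sq :
  scomp (sexp_post Y (str X)) (sexp_pre X f) =
  scomp (sexp_pre S f) (sexp_post Z (str X)).
Proof. by apply: smap_eq => n h; apply: smap_eq. Qed.

Lemma map_over_pre_name : sexp_pre S f 0 (name (str Z)) = name (str Y).
Proof. by rewrite -(over_comm f); apply: smap_eq. Qed.

(* map_S(Z, X) -> map_S(Y, X) *)
Definition map_over_pre : smap (map_over Z X) (map_over Y X) :=
  fiber_map map_over_pre_sq map_over_pre_name.
End Precomposition.

Section FiberOver.
Variables (S : sset) (X Y : over S) (f : over_map X Y) (s : S 0).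

Lemma fiber_over_sq : scomp (str Y) f = scomp (sid S) (str X).
Proof. by rewrite over_comm; apply: smap_eq. Qed.

(* X_s -> Y_s *)
Definition fiber_over_map : smap (fiber (str X) s) (fiber (str Y) s) :=
  fiber_map fiber_over_sq (erefl : sid S 0 s = s).
End FiberOver.

Definition bivariant_equivalence (A B : sset) (Y Z : over (sprod A B))
    (f : over_map Y Z) : Prop :=
  forall X : over (sprod A B),
    bifibration (str X) -> homotopy_equivalence (map_over_pre f X).

Definition pointwise_weak_homotopy_equivalence (A B : sset)
    (X Y : over (sprod A B)) (f : over_map X Y) : Prop :=
  forall (a : A 0) (b : B 0),
    weak_homotopy_equivalence (fiber_over_map f ((a, b) : sprod A B 0)).

(* Main.v *)
(** Both conditions are equivalent to [f] being a homotopy equivalence over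
    [S = A x B].  A bivariant equivalence is one by testing against [X] and [Y],
    and homotopies over [S] restrict to fibers and act on [map_S(-, Z)].

    Conversely a pointwise equivalence has, over each vertex, the relative
    lifting property of homotopy equivalences between Kan complexes: a square
    from [bd Delta^n -> Delta^n] to [f] has a diagonal, up to a homotopy of the
    lower triangle relative to the boundary.  To get this over an arbitrary
    simplex [(alpha, beta)] of [S], contract [alpha] to its last vertex.  The
    contraction lifts forwards because it is constant in [B]; a solution at its
    end is carried back because on [n]-cells that are not in the boundary the
    only outer horn to fill sits at the last vertex, where the contraction is
    constant in [A].  Dually, contract [beta] to its first vertex.  A homotopy
    inverse over [S] is then built cell by cell. *)
From Stdlib Require Import Relations.
From mathcomp Require Import all_boot zify.
From mathcomp Require Import boolp classical_sets.
Require Import Defs.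

Set Implicit Arguments.
Unset Strict Implicit.
Unset Printing Implicit Defensive.

(** A bifibration is not a Kan fibration, so homotopies in the base lift only under conditions. Of
    the horns filled along a prism over $\Delta^n$, one is outer: it sits at the first vertex times
    $\Delta^1$ when lifting from the end 0, where degeneracy in $B$ is needed, and at the last
    vertex times $\Delta^1$ when lifting from the end 1, where degeneracy in $A$ is needed.
    Homotopies that are constant in the base lift from both ends, which is what allows homotopies
    over $S$ to be composed.

    Homotopy inverses chosen fiber by fiber would not fit together over neighbouring simplices,
    hence the relative form of the lifting property, with prescribed values on a subobject. On
    fibers it is derived without homotopy groups or base points: it holds for identities, is
    invariant under homotopy, and cancels from the two composites with a homotopy inverse. *)

(** * Monotone maps and surjections onto a simplex *)

Lemma mono_val_eq l m (a b : mono l m) : (forall i, a i = b i :> nat) -> a = b.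
Proof. by move=> ab; apply: mono_eq => i; apply: ord_inj. Qed.

Lemma end_cases (eps : 'I_2) : eps = ord0 \/ eps = ord_max.
Proof.
by case: eps => [[|[|//]] ?]; [left|right]; apply: val_inj.
Qed.

Lemma end_neq m : mono_cst m (ord0 : 'I_2) <> mono_cst m (ord_max : 'I_2).
Proof. by move=> /(congr1 (fun a : mono m 1 => val (a ord0))); rewrite !ffunE. Qed.

Definition onto m n (a : mono m n) : Prop := forall j, exists i, a i = j.

Lemma mono_cst_comp l m n (j : 'I_n.+1) (a : mono l m) :
  mono_comp (mono_cst m j) a = mono_cst l j.
Proof. by apply: mono_eq => i; rewrite !ffunE. Qed.

Lemma not_onto m n (a : mono m n) : ~ onto a <-> exists j, forall i, a i != j.
Proof.
split=> [/existsNP[j aj]|[j aj] /(_ j)[i ai]]; last first.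
  by move: (aj i); rewrite ai eqxx.
by exists j => i; apply/eqP => ai; apply: aj; exists i.
Qed.

Lemma not_onto_comp l m n (b : mono m n) (a : mono l m) :
  ~ onto b -> ~ onto (mono_comp b a).
Proof.
by move=> bN aN; apply: bN => j; have [i <-] := aN j; exists (a i); rewrite ffunE.
Qed.

(** A surjection between sets of equal size is injective, so [a] is strictly increasing; induction
    from the bottom bounds [a i] below by [i], induction from the top bounds it above. *)
Lemma onto_id n (a : mono n n) : onto a -> a = mono_id n.
Proof.
move=> aS.
have inj : injective a.
  apply/injectiveP/card_uniqP; rewrite size_map -cardE.
  apply: eq_card => j; have [i <-] := aS j.
  by rewrite inE; apply/mapP; exists i; rewrite ?mem_enum.
have lt (i j : 'I_n.+1) : i < j -> a i < a j.
  move=> ij; rewrite ltn_neqAle (mono_leq a (ltnW ij)) andbT.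
  by apply/eqP => /val_inj/inj e; move: ij; rewrite e ltnn.
have lo k (i : 'I_n.+1) : i = k :> nat -> k <= a i.
  elim: k i => // k IH i ik.
  have kn : k < n.+1 by apply: ltn_trans (ltn_ord i); rewrite ik.
  by apply: leq_ltn_trans (IH (Ordinal kn) erefl) (lt _ _ _); rewrite /= ik.
have hi k (i : 'I_n.+1) : n - i = k -> a i <= i.
  elim: k i => [|k IH] i ik.
    by move: (ltn_ord (a i)); lia.
  have kn : i.+1 < n.+1 by lia.
  move: (IH (Ordinal kn)) (lt i (Ordinal kn)) => /=; lia.
apply: mono_eq => i; rewrite ffunE; apply/val_inj/eqP.
by rewrite eqn_leq (hi _ _ erefl) (lo _ _ erefl).
Qed.

(** Any choice of preimages is monotone because [a] is, so the value over [a i] can be chosen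
    freely; this freedom later separates two maps that differ at [i]. *)
Lemma onto_section m n (a : mono m n) (i : 'I_m.+1) : onto a ->
  exists s : mono n m, mono_comp a s = mono_id n /\ s (a i) = i.
Proof.
move=> aS.
have pre j : exists k, a k = j /\ (j = a i -> k = i).
  case: (eqVneq j (a i)) => [->|ji]; first by exists i.
  by have [k ak] := aS j; exists k; split => // ej; rewrite ej eqxx in ji.
have [s sK] := boolp.choice pre.
have sM (j k : 'I_n.+1) : j <= k -> s j <= s k.
  apply: contraTT; rewrite -!ltnNge => ks.
  have := mono_leq a (ltnW ks); rewrite !(sK _).1 leq_eqVlt => /orP[/eqP e|//].
  by move: ks; rewrite (val_inj e) ltnn.
exists (mk_mono sM); split; last by rewrite ffunE (sK _).2.
by apply: mono_eq => j; rewrite !ffunE (sK j).1.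
Qed.

Lemma not_onto_factor m n (a : mono m n) : ~ onto a ->
  exists n' (d : mono n' n) (b : mono m n'), n' < n /\ a = mono_comp d b.
Proof.
move=> /not_onto[j aj]; case: n => [|n] in a j aj *.
  by move: (aj ord0); rewrite !ord1 eqxx.
have dP (k l : 'I_n.+1) : k <= l -> lift j k <= lift j l.
  by rewrite leq_bump2.
have bP (k l : 'I_m.+1) : k <= l ->
    (inord (unbump j (a k)) : 'I_n.+1) <= (inord (unbump j (a l)) : 'I_n.+1).
  move=> /(mono_leq a) h.
  have bnd i : unbump j (a i) < n.+1.
    move: (aj i) (ltn_ord (a i)) (ltn_ord j); rewrite -val_eqE /= /unbump; lia.
  rewrite !inordK //; move: h (aj k) (aj l).
  by rewrite -!val_eqE /= /unbump; lia.
exists n, (mk_mono dP), (mk_mono bP); split => //.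
apply: mono_eq => i; rewrite !ffunE; apply: val_inj => /=.
have ne : (a i != j :> nat) by exact: aj.
rewrite inordK ?unbumpKcond ?(negbTE ne) //.
move: ne (ltn_ord (a i)) (ltn_ord j); rewrite /unbump; lia.
Qed.

Lemma smap_app (X Y : sset) (f g : smap X Y) : f = g ->
  forall n x, f n x = g n x.
Proof. by move=> ->. Qed.

Lemma pull_to0 (X : sset) m n (a : mono m n) (s : X 0) :
  pull a (pull (mono_to0 n) s) = pull (mono_to0 m) s.
Proof. by rewrite -pull_comp mono_to0_comp. Qed.

Section SubLift.
Variables (X : sset) (P : forall n, X n -> Prop).
Hypothesis Pcl : forall m n (a : mono m n) (x : X n), P x -> P (pull a x).
Variables (Z : sset) (g : smap Z X).
Hypothesis gP : forall n (z : Z n), P (g n z).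

Lemma ssub_lift_nat m n (a : mono m n) (z : Z n) :
  exist (@P m) (g m (pull a z)) (gP (pull a z)) =
  pull a (exist (@P n) (g n z) (gP z) : ssub Pcl n).
Proof. by apply: sig_eq; rewrite /= smap_nat. Qed.

Definition ssub_lift : smap Z (ssub Pcl) := SMap (Y := ssub Pcl) ssub_lift_nat.
End SubLift.

Lemma spair_nat (Z A B : sset) (f : smap Z A) (g : smap Z B) m n (a : mono m n) z :
  (f m (pull a z), g m (pull a z)) = pull a ((f n z, g n z) : sprod A B n).
Proof. by rewrite !smap_nat. Qed.

Definition spair (Z A B : sset) (f : smap Z A) (g : smap Z B) : smap Z (sprod A B) :=
  SMap (Y := sprod A B) (spair_nat f g).

Definition simplex_map (X : sset) n (x : X n) : smap (Delta n) X :=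
  @SMap (Delta n) X (fun m a => pull a x) (fun _ _ a b => pull_comp b a x).

Lemma smap_Delta (X : sset) n (d : smap (Delta n) X) m (a : mono m n) :
  d m a = pull a (d n (mono_id n)).
Proof. by rewrite -smap_nat /= mono_1comp. Qed.

Definition end_incl (N : sset) (e : 'I_2) : smap N (sprod N (Delta 1)) :=
  @SMap N (sprod N (Delta 1)) (fun n x => (x, mono_cst n e))
    (fun m n a x => congr1 (pair _) (esym (mono_cst_comp e a))).

(** * Partial maps *)

(* A map defined on a subobject of [N], encoded by its graph so that compatible
   pieces glue by taking unions. *)
Record pmap (N E : sset) := PMap {
  prel :> forall n, N n -> E n -> Prop;
  prel_pull : forall m n (a : mono m n) x e,
    prel x e -> prel (pull a x) (pull a e);
  prel_fun : forall n (x : N n) e e', prel x e -> prel x e' -> e = e' }.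

Definition pdom N E (R : pmap N E) n (x : N n) : Prop := exists e, R n x e.

Lemma pdom_pull N E (R : pmap N E) m n (a : mono m n) (x : N n) :
  pdom R x -> pdom R (pull a x).
Proof. by case=> e xe; exists (pull a e); apply: prel_pull. Qed.

Definition pmap_empty (N E : sset) : pmap N E :=
  @PMap N E (fun _ _ _ => False) (fun _ _ _ _ _ h => h)
    (fun _ _ _ _ h _ => False_ind _ h).

Section PmapAlong.
Variables (B N E : sset) (i : smap B N) (g : smap B E).
Hypothesis i_inj : forall n (x y : B n), i n x = i n y -> x = y.

Definition along n (x : N n) (y : E n) := exists2 b, i n b = x & g n b = y.

Lemma along_pull m n (a : mono m n) x y : along x y -> along (pull a x) (pull a y).
Proof. by case=> b <- <-; exists (pull a b); rewrite smap_nat. Qed.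

Lemma along_fun n (x : N n) y y' : along x y -> along x y' -> y = y'.
Proof. by case=> b <- <- [b' /i_inj -> <-]. Qed.

Definition pmap_along : pmap N E := PMap along_pull along_fun.
End PmapAlong.

Section PmapPrecomp.
Variables (N' N E : sset) (s : smap N' N) (R : pmap N E).

Let rel n (x : N' n) (e : E n) := R n (s n x) e.

Let rel_pull m n (a : mono m n) x e : rel x e -> rel (pull a x) (pull a e).
Proof. by rewrite /rel smap_nat; apply: prel_pull. Qed.

Let rel_fun n (x : N' n) e e' : rel x e -> rel x e' -> e = e'.
Proof. exact: prel_fun. Qed.

Definition pmap_precomp : pmap N' E := PMap rel_pull rel_fun.
End PmapPrecomp.

(** The relation is functional and stable under [pull], so values picked by choice are automatically
    natural. *)
Lemma pmap_total N E (R : pmap N E) : (forall n (x : N n), pdom R x) ->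
  exists F : smap N E, forall n x, R n x (F n x).
Proof.
move=> RT; pose g n (x : N n) : E n := projT1 (cid (RT n x)).
have gP n (x : N n) : R n x (g n x) by rewrite /g; case: cid.
have gN m n (a : mono m n) (x : N n) : g m (pull a x) = pull a (g n x).
  by apply: (@prel_fun _ _ R) (gP _ _) _; apply: prel_pull.
by exists (SMap gN).
Qed.

(** The new simplex need not be embedded: its faces may be identified with one another inside the
    domain of [R], where the second hypothesis fixes their values. *)
Lemma attach_simplex N E (R : pmap N E) k (w : N k) (e : E k) :
  (forall m (a b : mono m k), pull a w = pull b w -> a = b \/ pdom R (pull a w)) ->
  (forall m (a : mono m k) y, R m (pull a w) y -> y = pull a e) ->
  exists R' : pmap N E, forall m (z : N m) y,
    R' m z y <-> R m z y \/ exists a, z = pull a w /\ y = pull a e.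
Proof.
move=> inj ext.
pose R' m (z : N m) y := R m z y \/ exists a, z = pull a w /\ y = pull a e.
have R'P m n (a : mono m n) x y : R' n x y -> R' m (pull a x) (pull a y).
  case=> [Rxy|[b [-> ->]]]; first by left; apply: prel_pull.
  by right; exists (mono_comp b a); rewrite !pull_comp.
have R'F n (x : N n) y y' : R' n x y -> R' n x y' -> y = y'.
  case=> [Rxy|[a [xa ya]]] [Rxy'|[b [xb yb]]].
  - exact: prel_fun Rxy Rxy'.
  - by rewrite yb; apply: ext; rewrite -xb.
  - by apply/esym; rewrite ya; apply: ext; rewrite -xa.
  - have [] := inj _ a b; first by rewrite -xa.
      by rewrite ya yb => ->.
    case=> z Rz; rewrite ya yb -(ext _ _ _ Rz).
    by apply: ext; rewrite -xb xa.
by exists (PMap R'P R'F).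
Qed.

Section CellularExtension.
Variables (N E : sset) (C : forall n, N n -> E n -> Prop) (R0 : pmap N E).
Hypothesis C_pull : forall m n (a : mono m n) x e, C x e -> C (pull a x) (pull a e).
Hypothesis R0C : forall n (x : N n) e, R0 n x e -> C x e.
Hypothesis cell : forall n (x : N n), ~ pdom R0 x -> forall w : pmap (Delta n) E,
  (forall m (a : mono m n), pdom (N := Delta n) w a <-> ~ onto a) ->
  (forall m (a : mono m n) e, w m a e -> C (pull a x) e) ->
  exists2 e, C x e & forall m (a : mono m n) y, w m a y -> y = pull a e.

Let ext (R : pmap N E) :=
  (forall n (x : N n) e, R0 n x e -> R n x e) /\
  (forall n (x : N n) e, R n x e -> C x e).

(** Zorn's lemma: the union of a chain is functional because any two members are comparable, and
    [R0] bounds the empty chain. *)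
Let maximal_extension : exists R : pmap N E, ext R /\
  forall R' : pmap N E, ext R' ->
    (forall n (x : N n) e, R n x e -> R' n x e) ->
    (forall n (x : N n) e, R' n x e -> R n x e).
Proof.
pose T := {R : pmap N E | ext R}.
pose le (R R' : T) := `[< forall n (x : N n) e, sval R n x e -> sval R' n x e >].
have R0ext : ext R0 by split.
have [|R S T'|A Atot|[R Rext] Rmax] := @ZL_preorder T (exist _ R0 R0ext) le.
- by move=> R; apply/asboolP.
- by move=> /asboolP RS /asboolP ST; apply/asboolP => n x e /RS/ST.
- case: (pselect (exists S, A S)) => [[S AS]|A0]; last first.
    by exists (exist _ R0 R0ext) => S AS; case: A0; exists S.
  pose U n (x : N n) e := exists2 R : T, A R & sval R n x e.
  have UP m n (a : mono m n) x e : U n x e -> U m (pull a x) (pull a e).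
    by case=> R AR Rxe; exists R => //; apply: prel_pull.
  have UF n (x : N n) e e' : U n x e -> U n x e' -> e = e'.
    move=> [R AR Rxe] [R' AR' Rxe'].
    case: (Atot R R' AR AR') => /asboolP sub.
      exact: prel_fun (sub _ _ _ Rxe) Rxe'.
    exact: prel_fun Rxe (sub _ _ _ Rxe').
  have Uext : ext (PMap UP UF).
    split=> n x e /=; first by move=> ?; exists S => //; apply: (svalP S).1.
    by case=> R AR; apply: (svalP R).2.
  by exists (exist _ _ Uext) => R AR; apply/asboolP => n x e Rxe; exists R.
- exists R; split => // R' R'ext sub.
  by have /asboolP := Rmax (exist _ R' R'ext) (introT (asboolP _) sub).
Qed.

(** A simplex outside a maximal extension, taken of least dimension, has its boundary in the domain,
    so [cell] supplies a value; attaching it contradicts maximality. *)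
Lemma cellular_extension : exists F : smap N E,
  (forall n (x : N n), C x (F n x)) /\ (forall n (x : N n) y, R0 n x y -> F n x = y).
Proof.
have [R [[R0R RC] Rmax]] := maximal_extension.
suff RT n (x : N n) : pdom R x.
  have [F FP] := pmap_total RT.
  exists F; split=> [n x|n x y /R0R Rxy]; first exact: RC.
  exact: prel_fun (FP _ _) Rxy.
elim/ltn_ind: n x => n IH x; apply: contrapT => xN.
have bdry m (a : mono m n) : ~ onto a -> pdom R (pull a x).
  move=> /not_onto_factor[n' [d [b [n'n ->]]]].
  by rewrite pull_comp; apply: pdom_pull; apply: IH.
pose w m (a : Delta n m) e := ~ onto a /\ R m (pull a x) e.
have wP l m (b : mono l m) (a : Delta n m) e :
    w m a e -> w l (pull b a) (pull b e).
  move=> [aN Rae]; split; first exact: not_onto_comp.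
  by rewrite pull_comp; apply: prel_pull.
have wF m (a : Delta n m) e e' : w m a e -> w m a e' -> e = e'.
  by move=> [_ h] [_ h']; apply: prel_fun h h'.
have xN0 : ~ pdom R0 x by case=> e /R0R Re; apply: xN; exists e.
have [|| e Cxe we] := @cell n x xN0 (PMap wP wF).
- move=> m a; split=> [[e []] //|aN].
  by have [e Re] := bdry m a aN; exists e.
- by move=> m a e [_ /RC].
have [||R' R'P] := @attach_simplex _ _ R n x e.
- move=> m a b ab.
  case: (pselect (onto a)) => [aS|aN]; last by right; apply: bdry.
  left; apply: contrapT => ne.
  have [i abi] : exists i, a i <> b i.
    by apply/existsNP => ab'; apply: ne; apply: mono_eq.
  (* A section of [a] through [i] shows that [x] is degenerate. *)
  have [s [as1 si]] := onto_section i aS.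
  have xE : x = pull (mono_comp b s) x.
    rewrite pull_comp -ab -pull_comp.
    by rewrite as1 pull_id.
  apply: xN; rewrite xE; apply: bdry => /onto_id.
  move=> /(congr1 (fun c : mono n n => c (a i))); rewrite !ffunE.
  by rewrite si => /esym.
(* For [a] onto, [x] is the pullback of [pull a x] along a section, so it would already lie in the
   domain. *)
- move=> m a y Ry; case: (pselect (onto a)) => [aS|aN]; last exact: we.
  case: xN; have [s [as1 _]] := onto_section ord0 aS.
  by rewrite -[x]pull_id -as1 pull_comp; apply: pdom_pull; exists y.
apply: xN; exists e; apply: Rmax.
- split=> m z y; first by move=> /R0R h; apply/R'P; left.
  move/R'P => [/RC//|[a [-> ->]]]; exact: C_pull.
- by move=> m z y h; apply/R'P; left.
- by apply/R'P; right; exists (mono_id n); rewrite !pull_id.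
Qed.
End CellularExtension.

(** * Homotopy lifting along prisms *)

(** The base simplex is fixed because a bifibration fills an outer horn only over particular
    simplices. *)
Definition has_fillers (X S : sset) (p : smap X S) n (i : 'I_n.+1) (s : S n) :=
  forall u : smap (horn i) X,
    lifting_problem p u (simplex_map s) -> has_diagonal_filler p u (simplex_map s).

Definition over_rel (X S : sset) (p : smap X S) W (H : smap W S) (R : pmap W X) :=
  forall n (z : W n) y, R n z y -> p n y = H n z.

Lemma attach_horn (X S : sset) (p : smap X S) W (H : smap W S) (R : pmap W X)
    n (i : 'I_n.+2) (w : W n.+1) :
  over_rel p H R ->
  (forall m (a b : mono m n.+1), pull a w = pull b w -> a = b) ->
  (forall m (a : mono m n.+1), pdom R (pull a w) <-> in_horn i (a : Delta n.+1 m)) ->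
  has_fillers p i (H _ w) ->
  exists R' : pmap W X, (forall m (z : W m) y, R m z y -> R' m z y) /\
    over_rel p H R' /\
    (forall m (z : W m), pdom R' z <-> pdom R z \/ exists a, z = pull a w).
Proof.
move=> Rover inj Rdom fill.
have [|u uQ] := pmap_total (R := pmap_precomp (scomp (simplex_map w) (horn_incl i)) R).
  by move=> m [a ha]; apply/Rdom.
have [|d [du pd]] := fill u.
  apply: smap_eq => m a /=; rewrite (Rover _ _ _ (uQ _ a)) smap_nat.
  by congr (pull _ _).
have dE m (a : mono m n.+1) : in_horn i (a : Delta n.+1 m) ->
    R m (pull a w) (pull a (d _ (mono_id _))).
  move=> ha; rewrite -smap_Delta.
  have := uQ m (exist _ (a : Delta n.+1 m) ha); rewrite -du; exact.
have pe : p _ (d _ (mono_id _)) = H _ w.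
  by have := smap_app pd (mono_id n.+1); rewrite /= pull_id.
have [||R' R'P] := @attach_simplex _ _ R _ w (d _ (mono_id _)).
- by move=> m a b /inj; left.
- move=> m a y Ry; apply: (prel_fun Ry); apply: dE; apply/Rdom; by exists y.
exists R'; split; first by move=> m z y h; apply/R'P; left.
split.
  move=> m z y /R'P[/Rover //|[a [-> ->]]].
  by rewrite !smap_nat pe.
move=> m z; split=> [[y /R'P[]]|[[y Ry]|[a ->]]].
- by left; exists y.
- by case=> a [-> _]; right; exists a.
- by exists y; apply/R'P; left.
- by eexists; apply/R'P; right; exists a.
Qed.

(* [shuffle k] is the simplex (0,0) ... (k,0) (k,1) ... (n,1) of the prism. *)
Section Prism.
Variable n : nat.

Lemma shuffle_subproof (k : 'I_n.+1) (i : 'I_n.+2) : i - (k < i) < n.+1.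
Proof. move: (ltn_ord i) (ltn_ord k); lia. Qed.

Lemma shuffle1_subproof (k : 'I_n.+1) (i j : 'I_n.+2) : i <= j ->
  (Ordinal (shuffle_subproof k i)) <= (Ordinal (shuffle_subproof k j)).
Proof. move=> /=; lia. Qed.

Lemma shuffle2_subproof (k : 'I_n.+1) (i j : 'I_n.+2) : i <= j ->
  (inord (k < i) : 'I_2) <= (inord (k < j) : 'I_2).
Proof. by move=> ij; rewrite !inordK; lia. Qed.

Definition shuffle (k : 'I_n.+1) : sprod (Delta n) (Delta 1) n.+1 :=
  (mk_mono (@shuffle1_subproof k), mk_mono (@shuffle2_subproof k)).

Lemma shuffle1E k m (a : mono m n.+1) i :
  (pull a (shuffle k)).1 i = a i - (k < a i) :> nat.
Proof. by rewrite !ffunE. Qed.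

Lemma shuffle2E k m (a : mono m n.+1) i :
  (pull a (shuffle k)).2 i = (k < a i) :> nat.
Proof. by rewrite !ffunE inordK; lia. Qed.

Lemma shuffle_inj k m (a b : mono m n.+1) :
  pull a (shuffle k) = pull b (shuffle k) -> a = b.
Proof.
move=> ab; apply: mono_val_eq => i.
have := shuffle1E k a i; have := shuffle2E k a i.
by rewrite ab shuffle1E shuffle2E; lia.
Qed.

(** The vertex (j, t) of the prism, if it lies on [shuffle k], is vertex number j + t of it; this
    gives the witness. *)
Lemma shuffleP (k : 'I_n.+1) m (z : sprod (Delta n) (Delta 1) m) :
  (forall i, z.2 i = 0 :> nat -> z.1 i <= k) ->
  (forall i, z.2 i = 1 :> nat -> k <= z.1 i) ->
  exists a : mono m n.+1, z = pull a (shuffle k).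
Proof.
case: z => a t /= h0 h1.
have t01 i : t i = 0 :> nat \/ t i = 1 :> nat by move: (ltn_ord (t i)); lia.
have bnd i : a i + t i < n.+2 by move: (ltn_ord (a i)) (t01 i); lia.
have cM (i j : 'I_m.+1) : i <= j -> Ordinal (bnd i) <= Ordinal (bnd j).
  by move=> ij /=; apply: leq_add; apply: mono_leq.
exists (mk_mono cM); apply: injective_projections; apply: mono_val_eq => i.
  by rewrite shuffle1E ffunE /=; move: (h0 i) (h1 i) (t01 i); lia.
by rewrite shuffle2E ffunE /=; move: (h0 i) (h1 i) (t01 i); lia.
Qed.

(** The first coordinate of [shuffle k] is the degeneracy identifying [k] with [k.+1], so only one
    of these two has to be hit. *)
Lemma shuffle_onto (k : 'I_n.+1) m (c : mono m n.+1) :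
  onto (pull c (shuffle k)).1 <->
  (forall j : 'I_n.+2, j != k :> nat -> j != k.+1 :> nat -> exists i, c i = j) /\
  (exists i, c i = k :> nat \/ c i = k.+1 :> nat).
Proof.
have E i := shuffle1E k c i.
split=> [h|[h1 [i0 h2]] j].
  split=> [j jk jk1|].
    have jn : j - (k < j) < n.+1 by move: (ltn_ord j) (ltn_ord k); lia.
    have [i ci] := h (Ordinal jn).
    exists i; apply: val_inj; move: (E i); rewrite ci /=; lia.
  have [i ci] := h k; exists i; move: (E i); rewrite ci; lia.
case: (eqVneq j k) => [->|jk].
  by exists i0; apply: ord_inj; rewrite E; lia.
have jn : j + (k < j) < n.+2 by move: (ltn_ord j); lia.
have {}jk : j != k :> nat by [].
have [||i ci] := h1 (Ordinal jn); rewrite /=; [lia|lia|].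
by exists i; apply: ord_inj; rewrite E ci /=; lia.
Qed.

Variables (X S : sset) (p : smap X S) (H : smap (sprod (Delta n) (Delta 1)) S).
Hypothesis p_inner : inner_fibration p.

Lemma inner_fillers m (i : 'I_m.+1) s : 0 < i < m -> has_fillers p i s.
Proof. by move=> im u; apply: p_inner. Qed.

(* Attaching the simplices [shuffle 0, ..., shuffle n] in this order, the domain
   before step [k] consists of the [(a, t)] with [a] not surjective or [a < k]
   where [t = 0]; [shuffle k] meets it in the horn opposite to [k + 1]. *)
Lemma prism_lift1 (R : pmap (sprod (Delta n) (Delta 1)) X) :
  over_rel p H R ->
  (forall m (a : mono m n) t, pdom (N := sprod (Delta n) (Delta 1)) R (a, t) <->
    ~ onto a \/ t = mono_cst m ord_max) ->
  has_fillers p (ord_max : 'I_n.+2) (H _ (shuffle ord_max)) ->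
  exists F : smap (sprod (Delta n) (Delta 1)) X,
    scomp p F = H /\ forall m z y, R m z y -> F m z = y.
Proof.
move=> Rover Rdom fill.
suff [R' [RR' [R'over R'dom]]] : exists R' : pmap (sprod (Delta n) (Delta 1)) X,
    (forall m z y, R m z y -> R' m z y) /\ over_rel p H R' /\
    (forall m (a : mono m n) t, pdom (N := sprod (Delta n) (Delta 1)) R' (a, t) <->
      ~ onto a \/ forall i, t i = 0 :> nat -> a i < n.+1).
  have [|F FP] := pmap_total (R := R').
    by move=> m [a t]; apply/R'dom; right.
  exists F; split; last by move=> m z y /RR' h; apply: prel_fun (FP m z) h.
  by apply: smap_eq => m z /=; apply: R'over; apply: FP.
suff step k : k <= n.+1 -> exists R' : pmap (sprod (Delta n) (Delta 1)) X,
    (forall m z y, R m z y -> R' m z y) /\ over_rel p H R' /\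
    (forall m (a : mono m n) t, pdom (N := sprod (Delta n) (Delta 1)) R' (a, t) <->
      ~ onto a \/ forall i, t i = 0 :> nat -> a i < k).
  exact: step.
elim: k => [_|k IH kn].
  exists R; split => //; split => // m a t.
  rewrite Rdom; split=> -[]; try by left.
    by move=> ->; right=> i; rewrite ffunE.
  move=> t1; right; apply: mono_val_eq => i; rewrite ffunE /=.
  by move: (t1 i) (ltn_ord (t i)); lia.
have [R' [RR' [R'over R'dom]]] := IH (ltnW kn).
have k1n : k.+1 < n.+2 by [].
have [|||R2 [R'R2 [R2over R2dom]]] :=
  @attach_horn _ _ p _ H R' n (Ordinal k1n) (shuffle (Ordinal kn)) R'over.
- exact: shuffle_inj.
(* A face missing [k] satisfies [a < k] wherever [t = 0]; a face missing a vertex other than [k] and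
   [k.+1] has a first coordinate that is not onto. Together they form the horn at [k.+1]. *)
- move=> m c; rewrite [pull _ _]surjective_pairing R'dom shuffle_onto.
  split=> [|[j jk cj]].
    move=> [h|h].
      apply: contrapT => hn; apply: h; split.
        move=> j jk jk1; apply: contrapT => cN; apply: hn; exists j => //.
        by move=> i; apply/eqP => ci; apply: cN; exists i.
      apply: contrapT => cN; apply: hn; exists (inord k).
        by rewrite -val_eqE /= inordK; lia.
      move=> i; apply/eqP => ci; apply: cN; exists i; left.
      by rewrite ci /= inordK; lia.
    exists (inord k); first by rewrite -val_eqE /= inordK; lia.
    move=> i; apply/eqP => ci; have ck : c i = k :> nat by rewrite ci /= inordK; lia.
    move: (h i); rewrite (shuffle1E _ c) (shuffle2E _ c) /= ck; lia.
  case: (eqVneq (j : nat) k) => [jk'|jk']; last first.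
    by left=> -[/(_ j jk' jk)[i ci] _]; move: (cj i); rewrite ci eqxx.
  case: (pselect (exists i, c i = k.+1 :> nat)) => [ck|cN]; last first.
    left=> -[_ [i [ci|ci]]]; last by apply: cN; exists i.
    by move: (cj i); rewrite -val_eqE /= ci jk' eqxx.
  right=> i; rewrite (shuffle1E _ c) (shuffle2E _ c) /= => ci.
  by move: (cj i); rewrite -val_eqE /= jk'; lia.
(* In dimension [n.+1] the horn at [k.+1] is inner unless [k = n]; only that last step uses
   [fill]. *)
- case: (ltngtP k n) => [kn'|kn'|kn'].
  + by apply: inner_fillers; rewrite /=; lia.
  + lia.
  + have -> : Ordinal k1n = ord_max by apply: val_inj => /=; rewrite kn'.
    suff -> : (Ordinal kn) = ord_max by []; by apply: val_inj => /=.
exists R2; split; first by move=> m z y /RR'; apply: R'R2.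
split=> // m a t; rewrite R2dom R'dom; split.
  case=> [[h|h]|[c zE]].
  - by left.
  - by right=> i /h/leqW.
  - right=> i; have := shuffle1E (Ordinal kn) c i.
    by have := shuffle2E (Ordinal kn) c i; rewrite -zE /=; lia.
case=> [h|h]; first by left; left.
case: (pselect (onto a)) => [aS|]; last by left; left.
case: (pselect (exists i, t i = 0 :> nat /\ a i = k :> nat)) => [[i0 [ti ai]]|N].
  right; apply: shuffleP => i /=; first by move/h.
  move=> ti1; rewrite -ai; apply: mono_leq; rewrite leqNgt; apply/negP => ii.
  by have := mono_leq t (ltnW ii); rewrite ti ti1.
left; right=> i ti; have := h i ti; rewrite ltnS leq_eqVlt => /orP[/eqP ai|//].
by case: N; exists i.
Qed.

(* The simplices are now attached in the opposite order; [shuffle k] meets the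
   previous stage in the horn opposite to [k]. *)
Lemma prism_lift0 (R : pmap (sprod (Delta n) (Delta 1)) X) :
  over_rel p H R ->
  (forall m (a : mono m n) t, pdom (N := sprod (Delta n) (Delta 1)) R (a, t) <->
    ~ onto a \/ t = mono_cst m ord0) ->
  has_fillers p (ord0 : 'I_n.+2) (H _ (shuffle ord0)) ->
  exists F : smap (sprod (Delta n) (Delta 1)) X,
    scomp p F = H /\ forall m z y, R m z y -> F m z = y.
Proof.
move=> Rover Rdom fill.
suff step k : k <= n.+1 -> exists R' : pmap (sprod (Delta n) (Delta 1)) X,
    (forall m z y, R m z y -> R' m z y) /\ over_rel p H R' /\
    (forall m (a : mono m n) t, pdom (N := sprod (Delta n) (Delta 1)) R' (a, t) <->
      ~ onto a \/ forall i, t i = 1 :> nat -> n.+1 - k <= a i).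
  have [R' [RR' [R'over R'dom]]] := step _ (leqnn _).
  have [|F FP] := pmap_total (R := R').
    by move=> m [a t]; apply/R'dom; right; rewrite subnn.
  exists F; split; last by move=> m z y /RR' h; apply: prel_fun (FP m z) h.
  by apply: smap_eq => m z /=; apply: R'over; apply: FP.
elim: k => [_|k IH kn].
  exists R; split => //; split => // m a t.
  rewrite Rdom subn0; split=> -[]; try by left.
    by move=> ->; right=> i; rewrite ffunE.
  move=> t1; right; apply: mono_val_eq => i; rewrite ffunE /=.
  by move: (t1 i) (ltn_ord (t i)) (ltn_ord (a i)); lia.
have [R' [RR' [R'over R'dom]]] := IH (ltnW kn).
have rn : n - k < n.+1 by lia.
have -> : n.+1 - k.+1 = n - k by lia.
have Er : n.+1 - k = (n - k).+1 by lia.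
(* From here [r = n - k] is the index of the attached simplex; the final step has [r = 0] and meets
   the outer horn at the first vertex. *)
move: (n - k) rn Er R'dom => r rn -> R'dom {k IH kn}.
have r1n : r < n.+2 by lia.
have [|||R2 [R'R2 [R2over R2dom]]] :=
  @attach_horn _ _ p _ H R' n (Ordinal r1n) (shuffle (Ordinal rn)) R'over.
- exact: shuffle_inj.
- move=> m c; rewrite [pull _ _]surjective_pairing R'dom shuffle_onto.
  split=> [|[j jk cj]].
    move=> [h|h].
      apply: contrapT => hn; apply: h; split.
        move=> j jk jk1; apply: contrapT => cN; apply: hn; exists j => //.
        by move=> i; apply/eqP => ci; apply: cN; exists i.
      apply: contrapT => cN; apply: hn; exists (inord r.+1).
        by rewrite -val_eqE /= inordK; lia.
      move=> i; apply/eqP => ci; apply: cN; exists i; right.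
      by rewrite ci /= inordK; lia.
    exists (inord r.+1); first by rewrite -val_eqE /= inordK; lia.
    move=> i; apply/eqP => ci; have ck : c i = r.+1 :> nat by rewrite ci /= inordK; lia.
    move: (h i); rewrite (shuffle1E _ c) (shuffle2E _ c) /= ck; lia.
  case: (eqVneq (j : nat) r.+1) => [jk'|jk']; last first.
    by left=> -[/(_ j jk jk')[i ci] _]; move: (cj i); rewrite ci eqxx.
  right=> i; rewrite (shuffle1E _ c) (shuffle2E _ c) /= => ci.
  by move: (cj i); rewrite -val_eqE /= jk'; lia.
- case: (posnP r) => [r0|r0]; last by apply: inner_fillers; rewrite /=; lia.
  have -> : Ordinal r1n = ord0 by apply: val_inj.
  suff -> : (Ordinal rn) = ord0 by []; by apply: val_inj => /=.
exists R2; split; first by move=> m z y /RR'; apply: R'R2.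
split=> // m a t; rewrite R2dom R'dom; split.
  case=> [[h|h]|[c zE]].
  - by left.
  - by right=> i /h; lia.
  - right=> i; have := shuffle1E (Ordinal rn) c i.
    by have := shuffle2E (Ordinal rn) c i; rewrite -zE /=; lia.
case=> [h|h]; first by left; left.
case: (pselect (exists i, t i = 1 :> nat /\ a i = r :> nat)) => [[i0 [ti ai]]|N].
  right; apply: shuffleP => i /=; last by move/h.
  move=> ti1; rewrite -ai; apply: mono_leq; rewrite leqNgt; apply/negP => ii.
  by have := mono_leq t (ltnW ii); rewrite ti ti1.
left; right=> i ti; have := h i ti; rewrite leq_eqVlt => /orP[/eqP ai|//].
by case: N; exists i.
Qed.
End Prism.

Definition prism_map (N N' : sset) (i : smap N N') :
  smap (sprod N (Delta 1)) (sprod N' (Delta 1)) := sprod_map i (sid (Delta 1)).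

(* Homotopy lifting from the end [eps] of [N x Delta^1], relative to [M]. *)
Definition hlp (eps : 'I_2) (X S : sset) (p : smap X S) (N : sset)
    (M : forall n, N n -> Prop) (H : smap (sprod N (Delta 1)) S) : Prop :=
  forall R : pmap (sprod N (Delta 1)) X,
    over_rel p H R ->
    (forall n (x : N n), pdom (N := sprod N (Delta 1)) R (x, mono_cst n eps)) ->
    (forall n (x : N n) t, M n x -> pdom (N := sprod N (Delta 1)) R (x, t)) ->
    (forall n (x : N n) t y, R n (x, t) y -> M n x \/ t = mono_cst n eps) ->
    exists F : smap (sprod N (Delta 1)) X,
      scomp p F = H /\ forall n z y, R n z y -> F n z = y.

(** The form in which [hlp] is applied: the prescribed values come as a map on one end and a partial
    map over [M], agreeing where both are defined. *)
Lemma hlp_extend eps (X S : sset) (p : smap X S) (N : sset)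
    (M : forall n, N n -> Prop) H (g : smap N X) (Q : pmap (sprod N (Delta 1)) X) :
  hlp eps p M H ->
  (forall n x, p n (g n x) = H n (x, mono_cst n eps)) ->
  over_rel p H Q ->
  (forall n z, pdom (n := n) Q z <-> M n z.1) ->
  (forall n x y, Q n (x, mono_cst n eps) y -> g n x = y) ->
  exists F : smap (sprod N (Delta 1)) X,
    [/\ forall n z, p n (F n z) = H n z,
        forall n x, F n (x, mono_cst n eps) = g n x
      & forall n z y, Q n z y -> F n z = y].
Proof.
move=> pH gH QH Qdom Qg.
pose R n (z : sprod N (Delta 1) n) y :=
  (z.2 = mono_cst n eps /\ g n z.1 = y) \/ Q n z y.
have RP m n (a : mono m n) z y : R n z y -> R m (pull a z) (pull a y).
  case: z => x t [[/= -> <-]|Qy]; last by right; apply: prel_pull.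
  by left; rewrite -smap_nat /= mono_cst_comp.
have RF n z y y' : R n z y -> R n z y' -> y = y'.
  case: z => x t [[/= -> <-]|Qy] [[/= e <-]|Qy'] //.
  - exact: Qg Qy'.
  - by apply/esym/Qg; rewrite -e.
  - exact: prel_fun Qy Qy'.
have [||||F [<- FR]] := pH (PMap RP RF).
- by move=> n [x t] y [[/= -> <-]|/QH].
- by move=> n x; exists (g n x); left.
- move=> n x t Mx; have [y Qy] : pdom Q ((x, t) : sprod N (Delta 1) n) by apply/Qdom.
  by exists y; right.
- move=> n x t y [[/= -> _]|Qy]; first by right.
  by left; apply/(Qdom n (x, t)); exists y.
by exists F; split=> // n *; apply: FR; [left|right].
Qed.

Section HomotopyLifting.
Variables (eps : 'I_2) (X S : sset) (p : smap X S) (N : sset).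
Variables (M : forall n, N n -> Prop) (H : smap (sprod N (Delta 1)) S).
Hypothesis M_pull : forall m n (a : mono m n) (x : N n), M x -> M (pull a x).
Hypothesis cell : forall n (x : N n), ~ M x ->
  forall R : pmap (sprod (Delta n) (Delta 1)) X,
  over_rel p (scomp H (sprod_map (simplex_map x) (sid _))) R ->
  (forall m (a : mono m n) t, pdom (N := sprod (Delta n) (Delta 1)) R (a, t) <->
    ~ onto a \/ t = mono_cst m eps) ->
  exists F : smap (sprod (Delta n) (Delta 1)) X,
    scomp p F = scomp H (sprod_map (simplex_map x) (sid _)) /\
    forall m z y, R m z y -> F m z = y.

(** A homotopy on [N] is a map from [N] to the path object [E], hence can be built one simplex of
    [N] at a time; this leaves prisms over simplices outside [M]. *)
Lemma hlp_of_cells : hlp eps p M H.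
Proof.
move=> R Rover Reps RM Rdom; pose E := sexp (Delta 1) X.
pose C n (x : N n) (e : E n) := forall m (a : mono m n) t,
  p m (e m (a, t)) = H m (pull a x, t) /\
  forall y, R m (pull a x, mono_cst m eps) y -> e m (a, mono_cst m eps) = y.
pose R0 n (x : N n) (e : E n) := M x /\
  forall m (a : mono m n) t y, R m (pull a x, t) y -> e m (a, t) = y.
have R0P m n (a : mono m n) x e : R0 n x e -> R0 m (pull a x) (pull a e).
  move=> [Mx xe]; split; first exact: M_pull.
  by move=> l b t y; rewrite -pull_comp => /xe.
have R0F n (x : N n) e e' : R0 n x e -> R0 n x e' -> e = e'.
  move=> [Mx xe] [_ xe']; apply: smap_eq => m [a t].
  by have [y Ry] := RM _ _ t (M_pull a Mx); rewrite (xe _ _ _ _ Ry) (xe' _ _ _ _ Ry).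
have R0dom n (x : N n) : M x -> pdom (PMap R0P R0F) x.
  move=> Mx; have [|e eQ] := pmap_total (R := pmap_precomp (prism_map (simplex_map x)) R).
    by move=> m [a t]; apply: RM; apply: M_pull.
  exists e; split=> // m a t y Ry.
  exact: prel_fun (eQ m (a, t)) Ry.
have [|||G [GC GR]] := @cellular_extension N E C (PMap R0P R0F).
- move=> m n a x e h l b t.
  by have [h1 h2] := h l (mono_comp a b) t; rewrite -pull_comp; split.
- move=> n x e [Mx xe] m a t; split; last exact: xe.
  have [y Ry] := RM _ _ t (M_pull a Mx).
  by rewrite (xe _ _ _ _ Ry) (Rover _ _ _ Ry).
- move=> n x xN w wdom wC.
  (* The open box of the prism: over a boundary face the path [e] is evaluated at the top simplex
     [mono_id m], and on the end [eps] the value comes from [R]. *)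
  pose Rc m (z : sprod (Delta n) (Delta 1) m) y :=
    (exists2 e, w m z.1 e & y = e m (mono_id m, z.2)) \/
    (z.2 = mono_cst m eps /\ R m (pull z.1 x, mono_cst m eps) y).
  have RcP l m (b : mono l m) z y : Rc m z y -> Rc l (pull b z) (pull b y).
    case: z => a t [[e wae ->]|[/= -> Ry]].
      left; exists (pull b e); first exact: prel_pull.
      by rewrite -(smap_nat e) /= /sprod_pull /= mono_1comp mono_comp1.
    right; split; rewrite /= ?mono_cst_comp // pull_comp.
    have /= := prel_pull b Ry.
    by rewrite /sprod_pull /= mono_cst_comp.
  have RcF m z y y' : Rc m z y -> Rc m z y' -> y = y'.
    have mix e y1 a : w m a e -> R m (pull a x, mono_cst m eps) y1 ->
        e m (mono_id m, mono_cst m eps) = y1.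
      move=> /wC /(_ m (mono_id m) (mono_cst m eps))[_] h Ry; apply: h.
      by rewrite pull_id.
    case: z => a t [[e wae ->]|[/= -> Ry]] [[e' wae' ->]|[/= te Ry']].
    - by rewrite (prel_fun wae wae').
    - by rewrite te; apply: mix Ry'.
    - by apply/esym; apply: mix Ry.
    - exact: prel_fun Ry Ry'.
  have [||| F [pF FR]] := cell (x := x) _ (R := PMap RcP RcF).
  + by move=> /R0dom.
  + move=> m [a t] y /= [[e /= wae ->]|[/= -> Ry]]; last exact: Rover Ry.
    by have [-> _] := wC _ _ _ wae m (mono_id m) t; rewrite pull_id.
  + move=> m a t; rewrite -wdom; split.
      case=> y [[e wae _]|[te _]]; last by right.
      by left; exists e.
    case=> [[e wae]|->]; first by eexists; left; exists e.
    have [y Ry] := Reps m (pull a x).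
    by exists y; right.
  exists F.
    move=> m a t; split.
      exact: (smap_app pF (a, t)).
    by move=> y Ry; apply: FR; right.
  move=> m a e wae; apply: smap_eq => l [b t] /=.
  apply/esym/FR; left; exists (pull b e).
    exact: prel_pull wae.
  by rewrite /= mono_comp1.
pose F n (z : sprod N (Delta 1) n) := G n z.1 n (mono_id n, z.2).
have FN m n (a : mono m n) (z : sprod N (Delta 1) n) :
    F m (pull a z) = pull a (F n z).
  rewrite /F /= (smap_nat G) -(smap_nat (G n z.1 : smap _ _)) /= /sprod_pull /=.
  by rewrite mono_1comp mono_comp1.
exists (SMap FN); split.
  apply: smap_eq => n [x t] /=.
  by have [-> _] := GC n x n (mono_id n) t; rewrite pull_id.
move=> n [x t] y Ry /=; rewrite /F /=.
case: (Rdom _ _ _ _ Ry) => [Mx|te].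
  have [e xe] := R0dom _ _ Mx.
  by rewrite (GR _ _ _ xe); apply: xe.2; rewrite pull_id.
have [_ h] := GC n x n (mono_id n) t.
by rewrite te; apply: h; rewrite pull_id -te.
Qed.
End HomotopyLifting.

Lemma shuffle_max_edge n :
  mono_comp (@shuffle n ord_max).1 (spine ord_max) = mono_cst 1 ord_max /\
  mono_comp (@shuffle n ord_max).2 (spine ord_max) = mono_id 1.
Proof.
split; apply: mono_val_eq => i; rewrite !ffunE /=.
  by rewrite inordK; move: (ltn_ord i); lia.
by rewrite !inordK; move: (ltn_ord i); lia.
Qed.

Lemma shuffle_min_edge n :
  mono_comp (@shuffle n ord0).1 (spine ord0) = mono_cst 1 ord0 /\
  mono_comp (@shuffle n ord0).2 (spine ord0) = mono_id 1.
Proof.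
split; apply: mono_val_eq => i; rewrite !ffunE /=.
  by rewrite inordK; move: (ltn_ord i); lia.
by rewrite !inordK; move: (ltn_ord i); lia.
Qed.

Section HlpInstances.
Variables (N : sset) (M : forall n, N n -> Prop).
Hypothesis M_pull : forall m n (a : mono m n) (x : N n), M x -> M (pull a x).

(** By [shuffle_max_edge] the critical edge of the outer horn is the last vertex of [x] times
    [Delta 1]. Only simplices outside [M] are tested, since only their prisms get filled;
    [cell_lift_transport] relies on this to carry solutions back. *)
Lemma bifibration_hlp1 (X A B : sset) (p : smap X (sprod A B))
    (H : smap (sprod N (Delta 1)) (sprod A B)) :
  bifibration p ->
  (forall n (x : N n), ~ M x ->
    degenerate_edge (H 1 (pull (mono_cst 1 ord_max) x, mono_id 1)).1) ->
  hlp ord_max p M H.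
Proof.
move=> pX Hdeg; apply: hlp_of_cells => // n x xN R Rover Rdom.
apply: prism_lift1 Rover Rdom _; first exact: bifib_inner.
move=> u uP; apply: (bifib_right pX) uP _.
suff -> : edge_of (scomp (sfst A B) (simplex_map
    (scomp H (sprod_map (simplex_map x) (sid _)) _ (shuffle ord_max)))) ord_max =
  (H 1 (pull (mono_cst 1 ord_max) x, mono_id 1)).1 by exact: Hdeg.
rewrite /edge_of [LHS]/= -[LHS]/(pull (spine ord_max) (H _ (_, _))).1 -smap_nat.
by have [e1 e2] := shuffle_max_edge n; rewrite -e1 pull_comp -e2.
Qed.

Lemma bifibration_hlp0 (X A B : sset) (p : smap X (sprod A B))
    (H : smap (sprod N (Delta 1)) (sprod A B)) :
  bifibration p ->
  (forall n (x : N n), ~ M x ->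
    degenerate_edge (H 1 (pull (mono_cst 1 ord0) x, mono_id 1)).2) ->
  hlp ord0 p M H.
Proof.
move=> pX Hdeg; apply: hlp_of_cells => // n x xN R Rover Rdom.
apply: prism_lift0 Rover Rdom _; first exact: bifib_inner.
move=> u uP; apply: (bifib_left pX) uP _.
suff -> : edge_of (scomp (ssnd A B) (simplex_map
    (scomp H (sprod_map (simplex_map x) (sid _)) _ (shuffle ord0)))) ord0 =
  (H 1 (pull (mono_cst 1 ord0) x, mono_id 1)).2 by exact: Hdeg.
rewrite /edge_of [LHS]/= -[LHS]/(pull (spine ord0) (H _ (_, _))).2 -smap_nat.
by have [e1 e2] := shuffle_min_edge n; rewrite -e1 pull_comp -e2.
Qed.

End HlpInstances.

Definition to_pt (X : sset) : smap X (Delta 0) :=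
  @SMap X (Delta 0) (fun n _ => mono_to0 n) (fun _ _ a _ => esym (mono_to0_comp a)).

Lemma to_pt_unique (X : sset) (f g : smap X (Delta 0)) : f = g.
Proof. by apply: smap_eq => n x; apply: mono_eq => i; rewrite !ord1. Qed.

Lemma kan_fillers (K : sset) n (i : 'I_n.+2) s :
  kan_complex K -> has_fillers (to_pt K) i s.
Proof.
by move=> KK u _; have [d du] := KK n i u; exists d; split=> //; apply: to_pt_unique.
Qed.

Lemma kan_hlp (K N : sset) (M : forall n, N n -> Prop) H eps :
  (forall m n (a : mono m n) (x : N n), M n x -> M m (pull a x)) ->
  kan_complex K -> hlp eps (to_pt K) M H.
Proof.
move=> M_pull KK.
have inner : inner_fibration (to_pt K).
  move=> [|n] i u s; first by rewrite ltn0 andbF.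
  rewrite (to_pt_unique s (simplex_map (X := Delta 0) (mono_to0 _))) => _.
  exact: kan_fillers.
apply: hlp_of_cells => // n x _ R Rover Rdom.
case: (end_cases eps) Rdom => -> Rdom.
  by apply: prism_lift0 Rover Rdom _; rewrite //; apply: kan_fillers.
by apply: prism_lift1 Rover Rdom _; rewrite //; apply: kan_fillers.
Qed.

(** The edges of a constant homotopy over vertices of [N] are degenerate in both factors, so either
    outer horn can be filled. *)
Lemma bifibration_hlp_cst (X A B N : sset) (p : smap X (sprod A B))
    (M : forall n, N n -> Prop) (H : smap N (sprod A B)) eps :
  (forall m n (a : mono m n) (x : N n), M n x -> M m (pull a x)) ->
  bifibration p -> hlp eps p M (scomp H (sfst N (Delta 1))).
Proof.
move=> M_pull pX.
have deg n (i : 'I_n.+1) (x : N n) : pull (mono_cst 1 i) x =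
    pull (mono_to0 1) (pull (mono_cst 0 i) x).
  by rewrite -pull_comp mono_cst_comp.
case: (end_cases eps) => ->.
  apply: bifibration_hlp0 => // n x _ /=; rewrite deg smap_nat; by eexists.
apply: bifibration_hlp1 => // n x _ /=; rewrite deg smap_nat; by eexists.
Qed.

(* The square [N x Delta^1 x Delta^1] has coordinates [((x, r), t)]; the lift
   is prescribed for [t = eps], for [r = 0], for [r = 1] and over [M]. *)
Section Square.
Variables (eps : 'I_2) (X S : sset) (p : smap X S) (N : sset).
Variables (M : forall n, N n -> Prop).

Definition square_bdry n (z : sprod N (Delta 1) n) : Prop :=
  [\/ M z.1, z.2 = mono_cst n ord0 | z.2 = mono_cst n ord_max].

Lemma square_bdry_pull :
  (forall m n (a : mono m n) (x : N n), M x -> M (pull a x)) ->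
  forall m n (a : mono m n) (z : sprod N (Delta 1) n),
  square_bdry z -> square_bdry (pull a z).
Proof.
move=> M_pull m n a [x r] /= [/= Mx|/= ->|/= ->].
- by apply: Or31; apply: M_pull.
- by apply: Or32; apply: mono_cst_comp.
- by apply: Or33; apply: mono_cst_comp.
Qed.

Variables (H : smap (sprod (sprod N (Delta 1)) (Delta 1)) S).
Variables (g g0 g1 : smap (sprod N (Delta 1)) X).
Variable (Q : pmap (sprod (sprod N (Delta 1)) (Delta 1)) X).
Hypothesis pH : hlp eps p square_bdry H.
Hypothesis Q_dom : forall n z, pdom Q z <-> M (n := n) z.1.1.
Hypothesis gH : forall n x r, p n (g n (x, r)) = H n ((x, r), mono_cst n eps).
Hypothesis g0H : forall n x t, p n (g0 n (x, t)) = H n ((x, mono_cst n ord0), t).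
Hypothesis g1H : forall n x t, p n (g1 n (x, t)) = H n ((x, mono_cst n ord_max), t).
Hypothesis QH : over_rel p H Q.
Hypothesis g_g0 : forall n x, g n (x, mono_cst n ord0) = g0 n (x, mono_cst n eps).
Hypothesis g_g1 : forall n x, g n (x, mono_cst n ord_max) = g1 n (x, mono_cst n eps).
Hypothesis Qg : forall n x r y, Q n ((x, r), mono_cst n eps) y -> g n (x, r) = y.
Hypothesis Qg0 : forall n x t y, Q n ((x, mono_cst n ord0), t) y -> g0 n (x, t) = y.
Hypothesis Qg1 : forall n x t y, Q n ((x, mono_cst n ord_max), t) y -> g1 n (x, t) = y.

(** Read at the other end of [t], the lift is a homotopy in [r] joining the far ends of [g0] and
    [g1]; homotopies are composed and transported in this way. *)
Lemma hlp_square : exists F : smap (sprod (sprod N (Delta 1)) (Delta 1)) X,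
  [/\ scomp p F = H,
      forall n x r, F n ((x, r), mono_cst n eps) = g n (x, r),
      forall n x t, F n ((x, mono_cst n ord0), t) = g0 n (x, t),
      forall n x t, F n ((x, mono_cst n ord_max), t) = g1 n (x, t)
    & forall n z y, Q n z y -> F n z = y].
Proof.
pose R n (z : sprod (sprod N (Delta 1)) (Delta 1) n) y :=
  [\/ Q n z y, z.2 = mono_cst n eps /\ g n z.1 = y,
      z.1.2 = mono_cst n ord0 /\ g0 n (z.1.1, z.2) = y
    | z.1.2 = mono_cst n ord_max /\ g1 n (z.1.1, z.2) = y].
have RP m n (a : mono m n) z y : R n z y -> R m (pull a z) (pull a y).
  case: z => [[x r] t] [Qy|[/= -> <-]|[/= -> <-]|[/= -> <-]].
  - by apply: Or41; apply: prel_pull.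
  - by apply: Or42; rewrite -smap_nat /= mono_cst_comp.
  - by apply: Or43; rewrite -smap_nat /= mono_cst_comp.
  - by apply: Or44; rewrite -smap_nat /= mono_cst_comp.
have RF n z y y' : R n z y -> R n z y' -> y = y'.
  case: z => [[x r] t] [Qy|[/= e <-]|[/= e <-]|[/= e <-]];
    case=> [Qy'|[/= e' <-]|[/= e' <-]|[/= e' <-]] //; subst => //.
  - exact: prel_fun Qy Qy'.
  - by rewrite (Qg Qy).
  - by rewrite (Qg0 Qy).
  - by rewrite (Qg1 Qy).
  - by rewrite (Qg Qy').
  - by rewrite (Qg0 Qy').
  - by case: (end_neq e').
  - by rewrite (Qg1 Qy').
  - by case: (end_neq (esym e')).
have [||||F [pF FR]] := pH (R := PMap RP RF).
- move=> n [[x r] t] y /= [Qy|[/= -> <-]|[/= -> <-]|[/= -> <-]] //.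
  exact: QH Qy.
- by move=> n z; exists (g n z); apply: Or42.
- move=> n [x r] t [/= Mx|/= ->|/= ->].
  + by have /Q_dom[y Qy] : M ((x, r), t).1.1 by []; exists y; apply: Or41.
  + by exists (g0 n (x, t)); apply: Or43.
  + by exists (g1 n (x, t)); apply: Or44.
- move=> n [x r] t y [Qy|[/= -> _]|[/= -> _]|[/= -> _]]; last 2 first.
  + by left; apply: Or32.
  + by left; apply: Or33.
  + by left; apply: Or31; apply/(Q_dom ((x, r), t)); exists y.
  + by right.
exists F; split=> // n *; apply: FR; by [apply: Or41|apply: Or42|apply: Or43|apply: Or44].
Qed.
End Square.

(** * Maps of Kan complexes *)

(* For a map of Kan complexes, the vanishing of its relative homotopy groups. *)
Definition rel_lift (X Y : sset) (f : smap X Y) : Prop :=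
  forall (N : sset) (U : pmap N X) (v : smap N Y),
    (forall n (x : N n) y, U n x y -> f n y = v n x) ->
    exists (u : smap N X) (h : smap (sprod N (Delta 1)) Y),
    [/\ forall n x y, U n x y -> u n x = y,
        forall n x, h n (x, mono_cst n ord0) = f n (u n x),
        forall n x, h n (x, mono_cst n ord_max) = v n x
      & forall n (x : N n) t, pdom U x -> h n (x, t) = v n x].

(** What the first factor of a composite inherits from [rel_lift]: a solution without control over
    its image. *)
Definition rel_extension (X Y : sset) (f : smap X Y) : Prop :=
  forall (N : sset) (U : pmap N X) (v : smap N Y),
    (forall n (x : N n) y, U n x y -> f n y = v n x) ->
    exists u : smap N X, forall n x y, U n x y -> u n x = y.

Lemma rel_lift_id (X : sset) : rel_lift (sid X).
Proof.
move=> N U v Uv; exists v, (scomp v (sfst N (Delta 1))); split => //.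
by move=> n x y /Uv.
Qed.

(** Both ends are parameters so that an edge of a zigzag can be used in either direction. *)
Lemma rel_lift_homotopy (K L : sset) (f f' : smap K L)
    (gamma : smap (sprod (Delta 1) K) L) (eps eps' : 'I_2) :
  kan_complex L ->
  (forall n z, gamma n (mono_cst n eps, z) = f n z) ->
  (forall n z, gamma n (mono_cst n eps', z) = f' n z) ->
  rel_lift f -> rel_lift f'.
Proof.
move=> LK gf gf' lf N U v Uv.
pose rel n (z : sprod N (Delta 1) n) y := exists2 x, U n z.1 x & gamma n (z.2, x) = y.
have rel_pull m n (a : mono m n) z y : rel n z y -> rel m (pull a z) (pull a y).
  case=> x Ux <-; exists (pull a x); last by rewrite -smap_nat.
  exact: prel_pull.
have rel_fun n z y y' : rel n z y -> rel n z y' -> y = y'.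
  by case=> x Ux <- [x' Ux' <-]; rewrite (prel_fun Ux Ux').
pose Q := PMap rel_pull rel_fun.
have Qdom n z : pdom Q z <-> pdom (n := n) U z.1.
  split; first by case=> y [x Ux _]; exists x.
  by case=> x Ux; exists (gamma n (z.2, x)); exists x.
have U_pull m n (a : mono m n) (x : N n) : pdom U x -> pdom U (pull a x).
  exact: pdom_pull.
have pt n (a b : Delta 0 n) : a = b by apply: mono_eq => i; rewrite !ord1.
(* Deform [v] so that on the domain of [U] it follows [gamma] from [f'] back to [f]; the hypothesis
   on [f] then applies to the other end of [V]. *)
have [||||V [_ V1 VQ]] := hlp_extend (g := v) (Q := Q)
  (@kan_hlp L N (fun n x => pdom U x) (to_pt _) eps' U_pull LK).
- by move=> *; apply: pt.
- by move=> *; apply: pt.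
- exact: Qdom.
- by move=> n x y [w /= Uw <-]; rewrite gf' (Uv _ _ _ Uw).
have VU n x t w : U n x w -> V n (x, t) = gamma n (t, w).
  by move=> Uw; apply: VQ; exists w.
have [|u [h [Uu h0 h1 hU]]] := lf N U (scomp V (end_incl N eps)).
  by move=> n x y Uy /=; rewrite (VU _ _ _ _ Uy) gf.
have g0N m n (a : mono m n) (z : sprod N (Delta 1) n) :
    gamma m ((pull a z).2, u m (pull a z).1) = pull a (gamma n (z.2, u n z.1)).
  by rewrite -smap_nat /= [in LHS]smap_nat.
pose Q2 := pmap_precomp (spair (scomp (sfst _ _) (sfst _ (Delta 1)))
  (ssnd (sprod N (Delta 1)) _)) Q.
pose H := to_pt (sprod (sprod N (Delta 1)) (Delta 1)).
(* The homotopy [h] at [t = eps] is carried to [t = eps'] between the sides [gamma] applied to [u]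
   and [V]; over the domain of [U] nothing depends on [r]. *)
have [|||||||||||F [_ _ F0 F1 FQ]] := @hlp_square eps L _ (to_pt L) N
  (fun n x => pdom U x) H h (SMap g0N) V Q2.
- apply: kan_hlp => //; apply: (square_bdry_pull U_pull).
- by move=> n z; exact: (Qdom n ((z.1.1, z.2) : sprod N (Delta 1) n)).
- by move=> *; apply: pt.
- by move=> *; apply: pt.
- by move=> *; apply: pt.
- by move=> *; apply: pt.
- by move=> n x /=; rewrite h0 gf.
- by move=> n x; rewrite h1.
- move=> n x r y [z /= Uz <-]; rewrite hU /= ?(VU _ _ _ _ Uz) //; by exists z.
- by move=> n x t y [z /= Uz <-]; rewrite (Uu _ _ _ Uz).
- by move=> n x t y [z /= Uz <-]; apply: VU.
exists u, (scomp F (end_incl (sprod N (Delta 1)) eps')); split=> //= n x.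
- by rewrite F0 /= gf'.
- by rewrite F1.
- move=> t [z Uz].
  rewrite (FQ n ((x, t), mono_cst n eps') (gamma n (mono_cst n eps', z))).
    by rewrite gf' (Uv _ _ _ Uz).
  by exists z.
Qed.

Lemma edge_vertexE (M X : sset) (e : sexp M X 1) (i : 'I_2) (w : sexp M X 0) :
  pull (vertex i) e = w ->
  forall n z, e n (mono_cst n i, z) = w n (mono_to0 n, z).
Proof. by move=> <- n z /=; rewrite mono_cst_comp. Qed.

Lemma unname_nat (M X : sset) (w : sexp M X 0) m n (a : mono m n) (x : M n) :
  w m (mono_to0 m, pull a x) = pull a (w n (mono_to0 n, x)).
Proof. by rewrite -smap_nat /= /sprod_pull /= mono_to0_comp. Qed.

Definition unname (M X : sset) (w : sexp M X 0) : smap M X := SMap (unname_nat w).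

Lemma unnameK (M X : sset) (w : sexp M X 0) : name (unname w) = w.
Proof.
apply: smap_eq => n [a x] /=; congr (w n (_, x)).
by apply: mono_eq => i; rewrite !ord1.
Qed.

Lemma nameK (M X : sset) (f : smap M X) : unname (name f) = f.
Proof. exact: smap_eq. Qed.

Lemma rel_lift_homotopic (K L : sset) (f f' : smap K L) :
  kan_complex L -> homotopic f f' -> rel_lift f <-> rel_lift f'.
Proof.
move=> LK.
suff gen (w w' : sexp K L 0) : connected w w' ->
    rel_lift (unname w) <-> rel_lift (unname w').
  by move=> /gen; rewrite !nameK.
elim=> {w w'} [w w' [e [/edge_vertexE e0 /edge_vertexE e1]]|w|w w' _ IH
  |w w' w'' _ IH _ IH'].
- split; refine (@rel_lift_homotopy K L (unname _) (unname _) e _ _ LK _ _);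
    by [exact: e0|exact: e1].
- by [].
- by split=> /IH.
- exact: (iff_trans IH IH').
Qed.

Lemma rel_extension_of_comp (X Y Z : sset) (g : smap Y Z) (f : smap X Y) :
  rel_lift (scomp g f) -> rel_extension f.
Proof.
move=> lgf N U v Uv; have [|u [_ [Uu _ _ _]]] := lgf N U (scomp g v).
  by move=> n x y /Uv /= ->.
by exists u.
Qed.

(** The lifting for [g f] gives a homotopy in [Z] from [g f u] to [g v]. Extension along [g], with
    both ends and the domain of [U] prescribed, produces one in [Y] from [f u] to [v]. *)
Lemma rel_lift_of_comp (X Y Z : sset) (f : smap X Y) (g : smap Y Z) :
  rel_lift (scomp g f) -> rel_extension g -> rel_lift f.
Proof.
move=> lgf eg N U v Uv; have [|u [h [Uu h0 h1 hU]]] := lgf N U (scomp g v).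
  by move=> n x y /Uv /= ->.
pose W n (z : sprod N (Delta 1) n) y :=
  [\/ z.2 = mono_cst n ord0 /\ f n (u n z.1) = y,
      z.2 = mono_cst n ord_max /\ v n z.1 = y | pdom U z.1 /\ v n z.1 = y].
have WP m n (a : mono m n) z y : W n z y -> W m (pull a z) (pull a y).
  case=> [[e <-]|[e <-]|[e <-]].
  - by apply: Or31; rewrite -!smap_nat /= e mono_cst_comp.
  - by apply: Or32; rewrite -!smap_nat /= e mono_cst_comp.
  - by apply: Or33; rewrite -!smap_nat; split => //; apply: pdom_pull.
have fu n x : pdom U x -> f n (u n x) = v n x.
  by case=> y Uy; rewrite (Uu _ _ _ Uy) (Uv _ _ _ Uy).
have WF n z y y' : W n z y -> W n z y' -> y = y'.
  case=> [[e <-]|[e <-]|[e <-]] [[e' <-]|[e' <-]|[e' <-]] //.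
  - by case: (@end_neq n); rewrite -e -e'.
  - exact: fu.
  - by case: (@end_neq n); rewrite -e -e'.
  - by apply/esym/fu.
have [|k kW] := eg _ (PMap WP WF) h.
  move=> n [x t] y [[/= -> <-]|[/= -> <-]|[/= e <-]].
  - by rewrite h0.
  - by rewrite h1.
  - by rewrite hU.
exists u, k; split=> // n x.
- by apply: kW; apply: Or31.
- by apply: kW; apply: Or32.
- by move=> t Ux; apply: kW; apply: Or33.
Qed.

Lemma connected_map (X Y : sset) (f : smap X Y) x x' :
  connected x x' -> connected (f 0 x) (f 0 x').
Proof.
elim=> [w w' [e [<- <-]]|w|w w' _ IH|w w' w'' _ IH _ IH'].
- by apply: rst_step; exists (f 1 e); rewrite !smap_nat.
- exact: rst_refl.
- exact: rst_sym.
- exact: rst_trans IH IH'.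
Qed.

Lemma homotopic_comp (X Y Z W : sset) (g : smap Y Z) (f f' : smap X Y) (k : smap W X) :
  homotopic f f' -> homotopic (scomp g (scomp f k)) (scomp g (scomp f' k)).
Proof.
move=> ff'; have := connected_map (sexp_pre Z k) (connected_map (sexp_post X g) ff').
by rewrite /homotopic; congr connected; apply: smap_eq.
Qed.

(** Surjectivity for [K] gives [g] with [g f] homotopic to the identity. Then [f g f] is homotopic
    to [f], and injectivity for [L] cancels the right-hand [f]. *)
Lemma whe_homotopy_inverse (K L : sset) (f : smap K L) :
  kan_complex K -> kan_complex L -> weak_homotopy_equivalence f ->
  exists g : smap L K, homotopic (scomp g f) (sid K) /\ homotopic (scomp f g) (sid L).
Proof.
move=> KK LK wf; have [_ /(_ (name (sid K)))[w wK]] := wf K KK.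
have gf : homotopic (scomp (unname w) f) (sid K).
  by move: wK; rewrite -[w]unnameK /homotopic nameK; congr connected; apply: smap_eq.
exists (unname w); split=> //.
have [inj _] := wf L LK; apply: inj.
have := homotopic_comp f (sid K) gf.
by rewrite /homotopic; congr connected; apply: smap_eq.
Qed.

(** The composite [f g] yields extension along [g], and with it the lifting for [g f] passes to
    [f]. *)
Lemma whe_rel_lift (K L : sset) (f : smap K L) :
  kan_complex K -> kan_complex L -> weak_homotopy_equivalence f -> rel_lift f.
Proof.
move=> KK LK /(whe_homotopy_inverse KK LK)[g [gf fg]].
apply: (@rel_lift_of_comp _ _ _ f g).
  by apply/(rel_lift_homotopic KK gf); apply: rel_lift_id.
apply: (@rel_extension_of_comp _ _ _ f g).
by apply/(rel_lift_homotopic LK fg); apply: rel_lift_id.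
Qed.

(** * Lifting cells over a base *)

Lemma not_onto_pull n l m (b : mono l m) (a : Delta n m) :
  ~ onto a -> ~ onto (pull b a : Delta n l).
Proof. exact: not_onto_comp. Qed.

Definition boundary n : sset := ssub (@not_onto_pull n).
Definition boundary_incl n : smap (boundary n) (Delta n) := ssub_incl (@not_onto_pull n).

Lemma boundary_incl_inj n m (x y : boundary n m) :
  boundary_incl n m x = boundary_incl n m y -> x = y.
Proof. exact: sig_eq. Qed.

Lemma sprod_id_inj (X Y Z : sset) (f : smap X Y) :
  (forall n (x y : X n), f n x = f n y -> x = y) ->
  forall n (x y : sprod X Z n),
    sprod_map f (sid Z) n x = sprod_map f (sid Z) n y -> x = y.
Proof. by move=> fi n [x z] [y z'] /= [/fi -> ->]. Qed.

Section OverBase.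
Variables (S : sset) (X Y : over S) (f : over_map X Y).

Lemma over_commE n (x : X n) : str Y n (f n x) = str X n x.
Proof. exact: (smap_app (over_comm f)). Qed.

Definition cell_lift n (v : smap (Delta n) Y) : Prop :=
  forall u : smap (boundary n) X, scomp f u = scomp v (boundary_incl n) ->
  exists (u' : smap (Delta n) X) (h : smap (sprod (Delta n) (Delta 1)) Y),
    [/\ scomp u' (boundary_incl n) = u,
        scomp h (end_incl _ ord0) = scomp f u',
        scomp h (end_incl _ ord_max) = v,
        scomp h (prism_map (boundary_incl n)) =
          scomp (scomp f u) (sfst _ _)
      & scomp (str Y) h = scomp (scomp (str Y) v) (sfst _ _)].

(* The problem lifts along [c] from its end [eps], is solved at the other end by
   assumption, and the solution is carried back along [c]. *)
Lemma cell_lift_transport (eps eps' : 'I_2) n (v : smap (Delta n) Y)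
    (c : smap (sprod (Delta n) (Delta 1)) S) :
  scomp c (end_incl _ eps) = scomp (str Y) v ->
  (forall (Z : over S) (N : sset) (pi : smap N (Delta n)) (M : forall m, N m -> Prop),
    Z = X \/ Z = Y ->
    (forall l m (a : mono l m) (x : N m), M m x -> M l (pull a x)) ->
    hlp eps (str Z) M (scomp c (prism_map pi))) ->
  (forall (Z : over S) (N : sset) (pi : smap N (Delta n)) (M : forall m, N m -> Prop),
    Z = X \/ Z = Y ->
    (forall l m (a : mono l m) (x : N m), M m x -> M l (pull a x)) ->
    (forall m x, ~ M m x -> onto (pi m x)) ->
    hlp eps' (str Z) M (scomp c (prism_map pi))) ->
  (forall v' : smap (Delta n) Y,
    scomp (str Y) v' = scomp c (end_incl _ eps') -> cell_lift v') ->
  cell_lift v.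
Proof.
move=> cv out back IH u uv.
have cvE m a : c m (a, mono_cst m eps) = str Y m (v m a) := smap_app cv a.
have uvE m a : f m (u m a) = v m (sval a) := smap_app uv a.
have bi := @sprod_id_inj _ _ (Delta 1) _ (@boundary_incl_inj n).
have bi2 := @sprod_id_inj _ _ (Delta 1) _ bi.
have domE Z g m (z : sprod (Delta n) (Delta 1) m) :
    pdom (@pmap_along _ _ Z _ g bi) z <-> ~ onto (z.1 : mono m n).
  case: z => a t; split=> [[y [[[b bN] t'] [<- _] _]] //|aN].
  by exists (g m (exist _ a aN, t)), (exist _ a aN, t).
have dom2E Z g m (z : sprod (sprod (Delta n) (Delta 1)) (Delta 1) m) :
    pdom (@pmap_along _ _ Z _ g bi2) z <-> ~ onto (z.1.1 : mono m n).
  case: z => -[a r] t; split=> [[y [[[[b bN] r'] t'] [<- _ _] _]] //|aN].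
  by exists (g m ((exist _ a aN, r), t)), ((exist _ a aN, r), t).
pose M m (a : Delta n m) := ~ onto a.
have M_pull l m (b : mono l m) (a : Delta n m) : M m a -> M l (pull b a).
  exact: not_onto_pull.
(* [U] moves the boundary lift [u] along [c] with nothing prescribed; [V] below moves [v] along [c]
   so as to agree with [f U] on the boundary. *)
have [||||U [UH U0 _]] := @hlp_extend eps _ _ (str X) _ (fun _ _ => False) _ u
  (pmap_empty _ _) (out X _ (boundary_incl n) (fun _ _ => False)
    (or_introl erefl) (fun _ _ _ _ h => h)).
- by move=> m a /=; rewrite cvE -uvE over_commE.
- by [].
- by move=> m z; split=> // -[].
- by [].
have [||||V [VH V0 VU]] := @hlp_extend eps _ _ (str Y) _ M _ v
  (pmap_along (scomp f U) bi) (out Y _ (sid _) M (or_intror erefl) M_pull).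
- by move=> m a /=; rewrite cvE.
- by move=> m _ _ [z <- <-] /=; rewrite over_commE UH.
- exact: domE.
- move=> m a y [[b t] [<- ->] <-] /=; by rewrite U0 uvE.
have [||u1 [h1 [u1U h10 h11 h1b h1S]]] := IH (scomp V (end_incl _ eps')) _
    (scomp U (end_incl _ eps')).
- by apply: smap_eq => m a /=; rewrite VH.
- apply: smap_eq => m a /=; apply/esym/VU; by exists (a, mono_cst m eps').
have {}u1U m b : u1 m (sval b) = U m (b, mono_cst m eps') := smap_app u1U b.
have {}h10 m a : h1 m (a, mono_cst m ord0) = f m (u1 m a) := smap_app h10 a.
have {}h11 m a : h1 m (a, mono_cst m ord_max) = V m (a, mono_cst m eps') :=
  smap_app h11 a.
have {}h1b m b r : h1 m (sval b, r) = f m (U m (b, mono_cst m eps')) :=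
  smap_app h1b (b, r).
have {}h1S m a r : str Y m (h1 m (a, r)) = str Y m (V m (a, mono_cst m eps')) :=
  smap_app h1S (a, r).
(* [W] carries the solution [u1] back; following [U] on the boundary, it arrives there at [u]. *)
have [||||W [WH W0 WU]] := @hlp_extend eps' _ _ (str X) _ M _ u1
  (pmap_along U bi) (back X _ (sid _) M (or_introl erefl) M_pull
    (fun m x => @contrapT _)).
- move=> m a /=; rewrite -over_commE -h10 h1S /= VH //.
- by move=> m _ _ [z <- <-] /=; rewrite UH.
- exact: domE.
- by move=> m a y [[b t] [<- ->] <-] /=; rewrite u1U.
(* The base of this square ignores [r], so carrying [h1] back between the sides [f W] and [V] ends
   in a homotopy over the original simplex. *)
have [|||||||||||F [FH F1 F0 Fm FQ]] := @hlp_square eps' _ _ (str Y) (Delta n) M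
  (scomp c (prism_map (sfst (Delta n) (Delta 1)))) h1 (scomp f W) V
  (pmap_along (scomp (scomp f U) (sprod_map (sfst _ _) (sid _))) bi2).
- apply: back; [by right|exact: square_bdry_pull|].
  by move=> m z zN; apply: contrapT => zN'; apply: zN; apply: Or31.
- exact: dom2E.
- by move=> m a r; rewrite h1S /= VH.
- by move=> m a t /=; rewrite over_commE WH.
- by move=> m a t; rewrite VH.
- by move=> m _ _ [z <- <-] /=; rewrite over_commE UH.
- by move=> m a; rewrite h10 /= W0.
- by move=> m a; rewrite h11.
- by move=> m a r y [[[b r'] t] [<- -> ->] <-] /=; rewrite h1b.
- move=> m a t y [[[b r'] t'] [<- _ ->] <-] /=; congr (f m _).
  by apply: WU; exists (b, t).
- move=> m a t y [[[b r'] t'] [<- _ ->] <-] /=.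
  by apply: VU; exists (b, t).
exists (scomp W (end_incl _ eps)), (scomp F (end_incl _ eps)); split.
- apply: smap_eq => m b /=; rewrite -U0; apply: WU; by exists (b, mono_cst m eps).
- by apply: smap_eq => m a /=; rewrite F0.
- by apply: smap_eq => m a /=; rewrite Fm V0.
- apply: smap_eq => m [b r] /=; rewrite -U0; apply: FQ.
  by exists ((b, r), mono_cst m eps).
- apply: smap_eq => m [a r] /=.
  by rewrite [LHS](smap_app FH) /= cvE.
Qed.

Lemma fiber_cell_lift n (v : smap (Delta n) Y) (s : S 0) :
  rel_lift (fiber_over_map f s) ->
  (forall m a, str Y m (v m a) = pull (mono_to0 m) s) ->
  cell_lift v.
Proof.
move=> lf vs u uv.
have uvE m a : f m (u m a) = v m (sval a) := smap_app uv a.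
have us m a : in_fiber (str X) s (u m a).
  by rewrite /in_fiber -over_commE uvE /= vs.
pose u1 : smap _ (fiber (str X) s) := ssub_lift _ us.
pose v1 : smap _ (fiber (str Y) s) := ssub_lift _ vs.
have [|u' [h [Uu h0 h1 hU]]] := lf _ (pmap_along u1 (@boundary_incl_inj n)) v1.
  by move=> m _ _ [b <- <-]; apply: sig_eq; rewrite /= uvE.
exists (scomp (ssub_incl _) u'), (scomp (ssub_incl _) h); split; apply: smap_eq.
- by move=> m b /=; rewrite (Uu m (sval b) (u1 m b)) //; exists b.
- by move=> m a /=; rewrite h0.
- by move=> m a /=; rewrite h1.
- move=> m [b t] /=; rewrite hU /=; last by exists (u1 m b), b.
  by rewrite uvE.
- by move=> m [a t] /=; rewrite [RHS]vs; apply: (svalP (h m (a, t))).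
Qed.
End OverBase.

(** Over a constant simplex every edge is degenerate in both factors, so both outer horn conditions
    apply along with the inner one. *)
Lemma fiber_kan (A B X : sset) (p : smap X (sprod A B)) s :
  bifibration p -> kan_complex (fiber p s).
Proof.
move=> pX n i u.
pose s' : sprod A B n.+1 := pull (mono_to0 n.+1) s.
have up : lifting_problem p (scomp (ssub_incl _) u) (simplex_map s').
  apply: smap_eq => m a /=; rewrite [LHS](svalP (u m a)).
  exact: (esym (pull_to0 (X := sprod A B) (sval a) s)).
have [d [du pd]] : has_diagonal_filler p (scomp (ssub_incl _) u) (simplex_map s').
  have deg (j : 'I_n.+1) : edge_of (simplex_map s') j = pull (mono_to0 1) s.
    exact: pull_to0.
  case: (posnP i) => [i0|i0].
    have {}i0 : i = ord0 by apply: val_inj.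
    rewrite i0 in u up *; apply: (bifib_left pX up).
    by exists s.2; rewrite /= -[LHS]/(edge_of (simplex_map s') ord0).2 deg.
  case: (ltngtP i n.+1) => [il|il|il].
  - by apply: (bifib_inner pX) up; rewrite i0.
  - by move: (ltn_ord i); lia.
  - have {}il : i = ord_max by apply: val_inj.
    rewrite il in u up *; apply: (bifib_right pX up).
    by exists s.1; rewrite /= -[LHS]/(edge_of (simplex_map s') ord_max).1 deg.
have ds m a : in_fiber p s (d m a).
  by rewrite /in_fiber [LHS](smap_app pd); apply: pull_to0.
pose d1 : smap _ (fiber p s) := ssub_lift _ ds.
by exists d1; apply: smap_eq => m a; apply: sig_eq; apply: (smap_app du).
Qed.

(** * Contractions of a simplex and reduction to the fibers *)

Section Contractions.
Variable n : nat.

Lemma to_last_subproof m (z : sprod (Delta n) (Delta 1) m) (i j : 'I_m.+1) : i <= j ->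
  (if z.2 i == ord0 then z.1 i else ord_max) <= (if z.2 j == ord0 then z.1 j else ord_max).
Proof.
move=> ij; have := mono_leq z.2 ij; have := mono_leq z.1 ij.
case: eqP => [_|/eqP zi]; case: eqP => [->|_] //=; first by move=> *; apply: leq_ord.
by move: zi; rewrite -val_eqE /=; lia.
Qed.

Lemma from_first_subproof m (z : sprod (Delta n) (Delta 1) m) (i j : 'I_m.+1) : i <= j ->
  (if z.2 i == ord0 then ord0 else z.1 i) <= (if z.2 j == ord0 then ord0 else z.1 j).
Proof.
move=> ij; have := mono_leq z.2 ij; have := mono_leq z.1 ij.
case: eqP => [_|/eqP zi]; case: eqP => [->|_] //=.
by move: zi; rewrite -val_eqE /=; lia.
Qed.

Lemma to_last_nat l m (a : mono l m) (z : sprod (Delta n) (Delta 1) m) :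
  mk_mono (@to_last_subproof l (pull a z)) =
  pull a (mk_mono (@to_last_subproof m z) : Delta n m).
Proof. by apply: mono_eq => i; rewrite !ffunE. Qed.

Lemma from_first_nat l m (a : mono l m) (z : sprod (Delta n) (Delta 1) m) :
  mk_mono (@from_first_subproof l (pull a z)) =
  pull a (mk_mono (@from_first_subproof m z) : Delta n m).
Proof. by apply: mono_eq => i; rewrite !ffunE. Qed.

Definition to_last : smap (sprod (Delta n) (Delta 1)) (Delta n) :=
  @SMap _ (Delta n) (fun m z => mk_mono (@to_last_subproof m z)) to_last_nat.
(** Monotonicity makes this contraction run away from the first vertex, with the identity at
    [t = 1]; hence the ends are exchanged in [cell_lift_contract_snd]. *)
Definition from_first : smap (sprod (Delta n) (Delta 1)) (Delta n) :=
  @SMap _ (Delta n) (fun m z => mk_mono (@from_first_subproof m z)) from_first_nat.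

Lemma to_last0 m (a : mono m n) : to_last m (a, mono_cst m ord0) = a.
Proof. by apply: mono_eq => i; rewrite !ffunE. Qed.

Lemma to_last1 m (a : mono m n) : to_last m (a, mono_cst m ord_max) = mono_cst m ord_max.
Proof. by apply: mono_eq => i; rewrite !ffunE. Qed.

Lemma from_first0 m (a : mono m n) : from_first m (a, mono_cst m ord0) = mono_cst m ord0.
Proof. by apply: mono_eq => i; rewrite !ffunE. Qed.

Lemma from_first1 m (a : mono m n) : from_first m (a, mono_cst m ord_max) = a.
Proof. by apply: mono_eq => i; rewrite !ffunE. Qed.

Lemma to_last_cst m (t : mono m 1) : to_last m (mono_cst m ord_max, t) = mono_cst m ord_max.
Proof. by apply: mono_eq => i; rewrite !ffunE; case: eqP. Qed.

Lemma from_first_cst m (t : mono m 1) : from_first m (mono_cst m ord0, t) = mono_cst m ord0.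
Proof. by apply: mono_eq => i; rewrite !ffunE; case: eqP. Qed.

Lemma onto_last m (a : mono m n) : onto a -> a ord_max = ord_max.
Proof.
move=> /(_ ord_max)[i ai]; apply/val_inj/eqP.
by rewrite eqn_leq leq_ord -[X in X <= _]/(val (ord_max : 'I_n.+1)) -ai mono_leq ?leq_ord.
Qed.

Lemma onto_first m (a : mono m n) : onto a -> a ord0 = ord0.
Proof.
move=> /(_ ord0)[i ai]; apply/val_inj/eqP.
by rewrite eqn_leq leq0n andbT -[X in _ <= X]/(val (ord0 : 'I_n.+1)) -ai mono_leq.
Qed.
End Contractions.

Lemma degenerate_cst (N A : sset) (g : smap N A) n (i : 'I_n.+1) (x : N n) :
  degenerate_edge (g 1 (pull (mono_cst 1 i) x)).
Proof.
exists (g 0 (pull (mono_cst 0 i) x)).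
by rewrite -smap_nat -pull_comp mono_cst_comp.
Qed.

Lemma degenerate_simplex (A : sset) n (i : 'I_n.+1) (g : smap (Delta n) A) :
  degenerate_edge (g 1 (mono_cst 1 i)).
Proof.
by exists (g 0 (mono_cst 0 i)); rewrite -smap_nat /= mono_cst_comp.
Qed.

Section Bifibrations.
Variables (A B : sset) (X Y : over (sprod A B)) (f : over_map X Y).
Hypotheses (hX : bifibration (str X)) (hY : bifibration (str Y)).

Let bif Z : Z = X \/ Z = Y -> bifibration (str Z).
Proof. by case=> ->. Qed.

Lemma cell_lift_contract_fst n (v : smap (Delta n) Y) :
  (forall (v' : smap (Delta n) Y) (a : A 0),
    (forall m x, (str Y m (v' m x)).1 = pull (mono_to0 m) a) -> cell_lift f v') ->
  cell_lift f v.
Proof.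
move=> IH; pose al := scomp (sfst A B) (scomp (str Y) v).
pose be := scomp (ssnd A B) (scomp (str Y) v).
apply: (@cell_lift_transport _ _ _ f ord0 ord_max n v
  (spair (scomp al (to_last n)) (scomp be (sfst _ _)))).
- apply: smap_eq => m a; apply: injective_projections => //.
  exact: (congr1 (al m) (to_last0 a)).
- move=> Z N pi M /bif hZ M_pull; apply: bifibration_hlp0 => // m x _.
  exact: (degenerate_cst (scomp be pi)).
(* A simplex mapping onto [Delta n] ends at the last vertex, which [to_last] fixes throughout. *)
- move=> Z N pi M /bif hZ M_pull onto_pi; apply: bifibration_hlp1 => // m x /onto_pi xo.
  have -> : (scomp (spair (scomp al (to_last n)) (scomp be (sfst (Delta n) (Delta 1))))
      (prism_map pi) 1 (pull (mono_cst 1 ord_max) x, mono_id 1)).1 = al 1 (mono_cst 1 ord_max).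
    have pix : pi 1 (pull (mono_cst 1 ord_max) x) = mono_cst 1 ord_max.
      by rewrite smap_nat; apply: mono_eq => i; rewrite !ffunE onto_last.
    transitivity (al 1 (to_last n 1 (pi 1 (pull (mono_cst 1 ord_max) x), mono_id 1))) => //.
    by rewrite pix to_last_cst.
  exact: degenerate_simplex.
- move=> v' v'E; apply: (IH v' (al 0 (mono_cst 0 ord_max))) => m x.
  rewrite [str Y m (v' m x)](smap_app v'E) //.
  transitivity (al m (to_last n m (x, mono_cst m ord_max))) => //.
  by rewrite to_last1 -smap_nat /= mono_cst_comp.
Qed.

(** The first coordinate is kept, so that after [cell_lift_contract_fst] this step lands in a single
    fiber. *)
Lemma cell_lift_contract_snd n (v : smap (Delta n) Y) :
  (forall (v' : smap (Delta n) Y) (b : B 0),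
    (forall m x, (str Y m (v' m x)).1 = (str Y m (v m x)).1) ->
    (forall m x, (str Y m (v' m x)).2 = pull (mono_to0 m) b) -> cell_lift f v') ->
  cell_lift f v.
Proof.
move=> IH; pose al := scomp (sfst A B) (scomp (str Y) v).
pose be := scomp (ssnd A B) (scomp (str Y) v).
apply: (@cell_lift_transport _ _ _ f ord_max ord0 n v
  (spair (scomp al (sfst _ _)) (scomp be (from_first n)))).
- apply: smap_eq => m a; apply: injective_projections => //.
  exact: (congr1 (be m) (from_first1 a)).
- move=> Z N pi M /bif hZ M_pull; apply: bifibration_hlp1 => // m x _.
  exact: (degenerate_cst (scomp al pi)).
- move=> Z N pi M /bif hZ M_pull onto_pi; apply: bifibration_hlp0 => // m x /onto_pi xo.
  have -> : (scomp (spair (scomp al (sfst (Delta n) (Delta 1))) (scomp be (from_first n)))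
      (prism_map pi) 1 (pull (mono_cst 1 ord0) x, mono_id 1)).2 = be 1 (mono_cst 1 ord0).
    have pix : pi 1 (pull (mono_cst 1 ord0) x) = mono_cst 1 ord0.
      by rewrite smap_nat; apply: mono_eq => i; rewrite !ffunE onto_first.
    transitivity (be 1 (from_first n 1 (pi 1 (pull (mono_cst 1 ord0) x), mono_id 1))) => //.
    by rewrite pix from_first_cst.
  exact: degenerate_simplex.
- move=> v' v'E; apply: (IH v' (be 0 (mono_cst 0 ord0))) => m x.
    by rewrite [str Y m (v' m x)](smap_app v'E).
  rewrite [str Y m (v' m x)](smap_app v'E) //.
  transitivity (be m (from_first n m (x, mono_cst m ord0))) => //.
  by rewrite from_first0 -smap_nat /= mono_cst_comp.
Qed.

Hypothesis hf : pointwise_weak_homotopy_equivalence f.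

Lemma pointwise_cell_lift n (v : smap (Delta n) Y) : cell_lift f v.
Proof.
apply: cell_lift_contract_fst => {}v a va.
apply: cell_lift_contract_snd => v' b v'v v'b.
apply: (@fiber_cell_lift _ _ _ f n v' ((a, b) : sprod A B 0)).
  by apply: whe_rel_lift; [exact: fiber_kan|exact: fiber_kan|exact: hf].
by move=> m x; rewrite [LHS]surjective_pairing v'v va v'b.
Qed.
End Bifibrations.

(* The coordinatewise minimum. *)
Definition meet : smap (sprod (Delta 1) (Delta 1)) (Delta 1) :=
  scomp (from_first 1) (spair (ssnd _ _) (sfst _ _)).

Lemma meet0l m (t : mono m 1) : meet m (mono_cst m ord0, t) = mono_cst m ord0.
Proof. exact: from_first0. Qed.

Lemma meet1l m (t : mono m 1) : meet m (mono_cst m ord_max, t) = t.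
Proof. exact: from_first1. Qed.

Lemma meet0r m (r : mono m 1) : meet m (r, mono_cst m ord0) = mono_cst m ord0.
Proof. exact: from_first_cst. Qed.

Lemma meet1r m (r : mono m 1) : meet m (r, mono_cst m ord_max) = r.
Proof.
apply: mono_eq => i; rewrite !ffunE /=; case: eqP => [->//|].
by case: (end_cases (r i)) => ->.
Qed.

(** * Lifting relative to a prescribed homotopy *)

Section CellHomotopy.
Variables (A B : sset) (X Y : over (sprod A B)) (f : over_map X Y).
Hypothesis hY : bifibration (str Y).

(** In [cell_lift] the homotopy is constant on the boundary, whereas gluing along neighbouring cells
    needs an arbitrary [k]. So [v] is moved back along an extension [V] of [k], the problem is
    solved there, and [V] is appended to the resulting homotopy. *)
Lemma cell_lift_homotopy n (v : smap (Delta n) Y) (u : smap (boundary n) X)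
    (k : smap (sprod (boundary n) (Delta 1)) Y) :
  (forall v' : smap (Delta n) Y, cell_lift f v') ->
  scomp k (end_incl _ ord0) = scomp f u ->
  scomp k (end_incl _ ord_max) = scomp v (boundary_incl n) ->
  scomp (str Y) k = scomp (scomp (str Y) (scomp v (boundary_incl n))) (sfst _ _) ->
  exists (u' : smap (Delta n) X) (h : smap (sprod (Delta n) (Delta 1)) Y),
    [/\ scomp u' (boundary_incl n) = u,
        scomp h (end_incl _ ord0) = scomp f u',
        scomp h (end_incl _ ord_max) = v,
        scomp h (prism_map (boundary_incl n)) = k
      & scomp (str Y) h = scomp (scomp (str Y) v) (sfst _ _)].
Proof.
move=> lift k0 k1 kS.
have {}k0 m b : k m (b, mono_cst m ord0) = f m (u m b) := smap_app k0 b.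
have {}k1 m b : k m (b, mono_cst m ord_max) = v m (sval b) := smap_app k1 b.
have {}kS m b t : str Y m (k m (b, t)) = str Y m (v m (sval b)) := smap_app kS (b, t).
have bi := @sprod_id_inj _ _ (Delta 1) _ (@boundary_incl_inj n).
have bi2 := @sprod_id_inj _ _ (Delta 1) _ bi.
pose M m (a : Delta n m) := ~ onto a.
have M_pull l m (b : mono l m) (a : Delta n m) : M m a -> M l (pull b a).
  exact: not_onto_pull.
have [||||V [VH V1 Vk]] := @hlp_extend _ _ _ (str Y) _ M _ v
  (pmap_along k bi) (@bifibration_hlp_cst _ _ _ _ (str Y) M (scomp (str Y) v) ord_max M_pull hY).
- by [].
- by move=> m _ _ [[b t] <- <-] /=; rewrite kS.
- move=> m [a t]; split=> [[y [[[b bN] t'] [<- _] _]] //|aN].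
  by exists (k m (exist _ a aN, t)), (exist _ a aN, t).
- by move=> m a y [[b t] [<- ->] <-]; rewrite k1.
have {}Vk m b t : V m (sval b, t) = k m (b, t) by apply: Vk; exists (b, t).
have [|u' [h' [u'u h0 h1 hb hS]]] := lift (scomp V (end_incl _ ord0)) u.
  by apply: smap_eq => m b /=; rewrite Vk k0.
have {}u'u m b : u' m (sval b) = u m b := smap_app u'u b.
have {}h0 m a : h' m (a, mono_cst m ord0) = f m (u' m a) := smap_app h0 a.
have {}h1 m a : h' m (a, mono_cst m ord_max) = V m (a, mono_cst m ord0) := smap_app h1 a.
have {}hb m b r : h' m (sval b, r) = f m (u m b) := smap_app hb (b, r).
have {}hS m a r : str Y m (h' m (a, r)) = str Y m (V m (a, mono_cst m ord0)) :=
  smap_app hS (a, r).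
(* On the boundary the square is [k] at the time min(r, t): constant on the sides [r = 0] and
   [t = 0], and [k] itself on the sides [r = 1] and [t = 1]. *)
pose Qk : smap (sprod (sprod (boundary n) (Delta 1)) (Delta 1)) Y :=
  scomp k (spair (scomp (sfst _ _) (sfst _ _))
    (scomp meet (spair (scomp (ssnd _ _) (sfst _ _)) (ssnd _ _)))).
have QkE m b r t : Qk m ((b, r), t) = k m (b, meet m (r, t)) by [].
have [|||||||||||F [FH F0 Fr0 Fr1 FQ]] := @hlp_square ord0 _ _ (str Y) (Delta n) M
  (scomp (scomp (scomp (str Y) v) (sfst _ _)) (sfst (sprod (Delta n) (Delta 1)) (Delta 1)))
  h' (scomp (scomp f u') (sfst _ _)) V (pmap_along Qk bi2).
- by apply: bifibration_hlp_cst hY; apply: square_bdry_pull.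
- move=> m [[a r] t]; split=> [[y [[[[b bN] r'] t'] [<- _ _] _]] //|aN].
  by exists (Qk m ((exist _ a aN, r), t)), ((exist _ a aN, r), t).
- by move=> m a r; rewrite hS VH.
- by move=> m a t; rewrite /= -h0 hS VH.
- by move=> m a t; rewrite VH.
- by move=> m _ _ [[[b r] t] <- <-]; rewrite QkE kS.
- by move=> m a /=; rewrite h0.
- by move=> m a; rewrite h1.
- by move=> m a r y [[[b r'] t] [<- -> ->] <-]; rewrite QkE meet0r k0 hb.
- by move=> m a t y [[[b r'] t'] [<- -> ->] <-]; rewrite QkE meet0l k0 /= u'u.
- by move=> m a t y [[[b r'] t'] [<- -> ->] <-]; rewrite QkE meet1l Vk.
exists u', (scomp F (end_incl _ ord_max)); split; apply: smap_eq.
- by move=> m b /=; rewrite u'u.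
- by move=> m a /=; rewrite Fr0.
- by move=> m a /=; rewrite Fr1 V1.
- move=> m [b r] /=; rewrite -[in RHS](meet1r r) -QkE; apply: FQ.
  by exists ((b, r), mono_cst m ord_max).
- by move=> m [a r]; rewrite [LHS](smap_app FH).
Qed.

(** Each simplex receives a lift to [X] together with a path in [Y] from its image to [v]; choosing
    the two at once makes the homotopies fit along common faces. *)
Lemma over_lift (N : sset) (v : smap N Y) (R : pmap N (sprod X (sexp (Delta 1) Y))) :
  (forall n (w : smap (Delta n) Y), cell_lift f w) ->
  (forall n z e, R n z e -> forall m (a : mono m n),
    [/\ forall t, str Y m (e.2 m (a, t)) = str Y m (v m (pull a z)),
        e.2 m (a, mono_cst m ord0) = f m (pull a e.1)
      & e.2 m (a, mono_cst m ord_max) = v m (pull a z)]) ->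
  exists (u : smap N X) (h : smap (sprod N (Delta 1)) Y),
    [/\ forall n x t, str Y n (h n (x, t)) = str Y n (v n x),
        forall n x, h n (x, mono_cst n ord0) = f n (u n x),
        forall n x, h n (x, mono_cst n ord_max) = v n x
      & forall n z e, R n z e -> u n z = e.1].
Proof.
move=> lift RC; pose E := sprod X (sexp (Delta 1) Y).
pose C n (z : N n) (e : E n) := forall m (a : mono m n),
  [/\ forall t, str Y m (e.2 m (a, t)) = str Y m (v m (pull a z)),
      e.2 m (a, mono_cst m ord0) = f m (pull a e.1)
    & e.2 m (a, mono_cst m ord_max) = v m (pull a z)].
have [|||F [FC FR]] := @cellular_extension N E C R.
- move=> m n a z e ze l b; have [h1 h2 h3] := ze l (mono_comp a b).
  by rewrite -pull_comp; split => //; rewrite /= -pull_comp.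
- exact: RC.
- move=> n z _ w wdom wC.
  have [W wW] : exists W : smap (boundary n) E, forall m b, w m (sval b) (W m b).
    have [|W WQ] := pmap_total (R := pmap_precomp (boundary_incl n) w); last by exists W.
    by move=> m [a aN]; apply/wdom.
  have kN l m (a : mono l m) (b : sprod (boundary n) (Delta 1) m) :
      (W l (pull a b).1).2 l (mono_id l, (pull a b).2) =
      pull a ((W m b.1).2 m (mono_id m, b.2)).
    rewrite /= (smap_nat W) -(smap_nat ((W m b.1).2 : smap _ _)) /= /sprod_pull /=.
    by rewrite mono_1comp mono_comp1.
  have WE m b : [/\ forall t, str Y m ((W m b).2 m (mono_id m, t)) =
        str Y m (v m (pull (sval b) z)),
      (W m b).2 m (mono_id m, mono_cst m ord0) = f m (W m b).1
    & (W m b).2 m (mono_id m, mono_cst m ord_max) = v m (pull (sval b) z)].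
    by have := wC _ _ _ (wW m b) m (mono_id m); rewrite !pull_id.
  have [||||u [h [uu h0 h1 hk hS]]] := @cell_lift_homotopy n
    (simplex_map (v n z)) (scomp (sfst _ _) W) (SMap kN).
  + exact: lift.
  + by apply: smap_eq => m b; have [] := WE m b.
  + by apply: smap_eq => m b; have [_ _] := WE m b; rewrite /= -smap_nat.
  + by apply: smap_eq => m [b t]; have [+ _ _] := WE m b; rewrite /= -smap_nat.
  exists ((u n (mono_id n), h) : E n).
    move=> m a; split=> [t||].
    * by rewrite [LHS](smap_app hS (a, t)) /= !smap_nat.
    * by rewrite [LHS](smap_app h0) /=; congr (f m _); apply: smap_Delta.
    * by rewrite [LHS](smap_app h1) /= smap_nat.
  move=> m a y way; have aN : ~ onto a by apply/wdom; exists y.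
  pose b : boundary n m := exist _ (a : Delta n m) aN.
  rewrite (prel_fun way (wW m b)); apply: injective_projections => /=.
    by rewrite -smap_Delta -[LHS](smap_app uu).
  apply: smap_eq => l [a' t] /=.
  have := smap_app hk (pull a' b, t) => /= ->.
  by rewrite (smap_nat W) /= mono_comp1.
have hN m n (a : mono m n) (z : sprod N (Delta 1) n) :
    (F m (pull a z).1).2 m (mono_id m, (pull a z).2) =
    pull a ((F n z.1).2 n (mono_id n, z.2)).
  rewrite /= (smap_nat F) -(smap_nat ((F n z.1).2 : smap _ _)) /= /sprod_pull /=.
  by rewrite mono_1comp mono_comp1.
exists (scomp (sfst _ _) F), (SMap hN); split=> /=.
- by move=> n x t; have [-> _ _] := FC n x n (mono_id n); rewrite pull_id.
- by move=> n x; have [_ -> _] := FC n x n (mono_id n); rewrite pull_id.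
- by move=> n x; have [_ _ ->] := FC n x n (mono_id n); rewrite pull_id.
- by move=> n z e /FR ->.
Qed.

End CellHomotopy.

(** * The homotopy inverse over the base *)

Lemma sexp_cst_nat (M Y : sset) m n (a : mono m n) (y : Y n) :
  scomp (simplex_map (pull a y)) (sfst (Delta m) M) =
  pull a (scomp (simplex_map y) (sfst _ _) : sexp M Y n).
Proof. by apply: smap_eq => l [b t] /=; rewrite -pull_comp. Qed.

Definition sexp_cst (M Y : sset) : smap Y (sexp M Y) :=
  @SMap Y (sexp M Y) (fun n y => scomp (simplex_map y) (sfst _ _)) (@sexp_cst_nat M Y).

Definition over_homotopic_id (S : sset) (X : over S) (phi : smap X X) : Prop :=
  exists h : smap (sprod X (Delta 1)) X,
    [/\ forall n x t, str X n (h n (x, t)) = str X n x,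
        forall n x, h n (x, mono_cst n ord0) = phi n x
      & forall n x, h n (x, mono_cst n ord_max) = x].

(** Lifting the identity of [Y] gives [g] and a homotopy [h] from [f g] to the identity. Lifting [h]
    along [f], a homotopy from [f g f] to [f], with [g f] and the identity prescribed at the ends,
    gives the homotopy for [g f]. *)
Lemma pointwise_homotopy_inverse (A B : sset) (X Y : over (sprod A B))
    (f : over_map X Y) :
  bifibration (str X) -> bifibration (str Y) ->
  pointwise_weak_homotopy_equivalence f ->
  exists g : over_map Y X,
    over_homotopic_id (scomp g f) /\ over_homotopic_id (scomp f g).
Proof.
move=> hX hY hf; have lift := pointwise_cell_lift hX hY hf.
have [|g [h [hS h0 h1 _]]] := over_lift hY (v := sid Y)
  (R := pmap_empty Y (sprod X (sexp (Delta 1) Y))) lift; first by [].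
have gS : scomp (str X) g = str Y.
  by apply: smap_eq => n y /=; rewrite -(over_commE f) -h0 hS.
pose c : smap X (sprod X (sexp (Delta 1) Y)) :=
  spair (sid X) (scomp (sexp_cst (Delta 1) Y) f).
(* At both ends the map to be lifted factors strictly through [f], so constant paths are prescribed
   there. *)
pose R n (z : sprod X (Delta 1) n) e :=
  (z.2 = mono_cst n ord0 /\ c n (g n (f n z.1)) = e) \/
  (z.2 = mono_cst n ord_max /\ c n z.1 = e).
have RP m n (a : mono m n) z e : R n z e -> R m (pull a z) (pull a e).
  case=> -[ze <-]; [left|right]; rewrite -!smap_nat; split=> //.
    by rewrite /= ze mono_cst_comp.
  by rewrite /= ze mono_cst_comp.
have RF n z e e' : R n z e -> R n z e' -> e = e'.
  move=> [] [ze <-] [] [ze' <-] //; by case: (@end_neq n); rewrite -ze -ze'.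
have [|k [k' [kS k0 k1 kR]]] := over_lift hY
  (v := scomp h (sprod_map f (sid (Delta 1)))) (R := PMap RP RF) lift.
  move=> n [x t] e [] [/= -> <-] m a.
    by rewrite /= mono_cst_comp -!smap_nat h0.
  by rewrite /= mono_cst_comp -!smap_nat h1.
exists (OverMap gS); split; last by exists h.
exists k; split=> [n x t|n x|n x].
- by rewrite -(over_commE f) -k0 kS /= hS over_commE.
- by rewrite (kR n _ (c n (g n (f n x)))) //; left.
- by rewrite (kR n _ (c n x)) //; right.
Qed.

(** * Action on mapping spaces and fibers *)

Lemma map_overP (S : sset) (M X : over S) n (y : map_over M X n) m (a : mono m n) x :
  str X m (sval y m (a, x)) = str M m x.
Proof. exact: (smap_app (svalP y) (a, x)). Qed.

Section Precompose.
Variables (S : sset) (X Z : over S).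
Variable h : smap (sprod X (Delta 1)) X.
Hypothesis hS : forall n x t, str X n (h n (x, t)) = str X n x.

Definition pre_homotopy_fun n (z : sprod (Delta 1) (map_over X Z) n) m
    (w : sprod (Delta n) X m) : Z m :=
  sval z.2 m (w.1, h m (w.2, pull w.1 z.1)).

Lemma pre_homotopy_fun_nat n z l m (a : mono l m) (w : sprod (Delta n) X m) :
  pre_homotopy_fun z (pull a w) = pull a (pre_homotopy_fun z w).
Proof.
rewrite /pre_homotopy_fun -smap_nat /= /sprod_pull /= -smap_nat /=.
by rewrite /sprod_pull /= mono_compA.
Qed.

Lemma pre_homotopy_fiber n z :
  in_fiber (sexp_post X (str Z)) (name (str X)) (SMap (@pre_homotopy_fun_nat n z)).
Proof.
by apply: smap_eq => m [a x]; rewrite /= /pre_homotopy_fun map_overP hS.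
Qed.

Lemma pre_homotopy_nat m n (a : mono m n) (z : sprod (Delta 1) (map_over X Z) n) :
  exist _ _ (pre_homotopy_fiber (pull a z)) =
  pull a (exist _ _ (pre_homotopy_fiber z) : map_over X Z n).
Proof.
apply: sig_eq; apply: smap_eq => l [b x].
by rewrite /= /pre_homotopy_fun /= mono_compA.
Qed.

Definition pre_homotopy : smap (sprod (Delta 1) (map_over X Z)) (map_over X Z) :=
  @SMap _ (map_over X Z) (fun n z => exist _ _ (pre_homotopy_fiber z)) pre_homotopy_nat.
End Precompose.

Lemma over_homotopic_id_pre (S : sset) (X Z : over S) (phi : smap (map_over X Z) (map_over X Z))
    (r : smap X X) :
  (forall n (y : map_over X Z n) m a x, sval (phi n y) m (a, x) = sval y m (a, r m x)) ->
  over_homotopic_id r -> homotopic phi (sid (map_over X Z)).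
Proof.
move=> phiE [h [hS h0 h1]]; apply: rst_step; exists (pre_homotopy Z hS); split.
  apply: smap_eq => n [t y]; apply: sig_eq; apply: smap_eq => m [a x].
  by rewrite /= /pre_homotopy_fun /= !mono_cst_comp h0 phiE.
apply: smap_eq => n [t y]; apply: sig_eq; apply: smap_eq => m [a x].
by rewrite /= /pre_homotopy_fun /= !mono_cst_comp h1.
Qed.

(** Evaluation at the vertex [x] is a simplicial map from $L^K$ to $L$, so it preserves
    components. *)
Lemma homotopic_app (K L : sset) (f g : smap K L) x :
  homotopic f g -> connected (f 0 x) (g 0 x).
Proof.
have evN m n (a : mono m n) (e : sexp K L n) :
    pull a e m (mono_id m, pull (mono_to0 m) x) =
    pull a (e n (mono_id n, pull (mono_to0 n) x)).
  rewrite /= -smap_nat /= /sprod_pull /= mono_comp1 mono_1comp.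
  by rewrite -pull_comp mono_to0_comp.
move=> /(connected_map (SMap evN)) /=.
have -> : mono_to0 0 = mono_id 0 by apply: mono_eq => i; rewrite !ord1.
by rewrite pull_id.
Qed.

Lemma homotopy_inverse_whe (K L : sset) (f : smap K L) (g : smap L K) :
  homotopic (scomp g f) (sid K) -> homotopic (scomp f g) (sid L) ->
  weak_homotopy_equivalence f.
Proof.
have pre (X Y : sset) (r : smap X X) (w : sexp X Y 0) :
    homotopic r (sid X) -> connected (sexp_pre Y r 0 w) w.
  rewrite -[w]unnameK => /(homotopic_comp (unname w) (sid X)).
  by rewrite /homotopic; congr connected; apply: smap_eq.
move=> gf fg Z _; split=> [a b ab|y].
  have /= ab' := connected_map (sexp_pre Z g) ab.
  apply: rst_trans (rst_trans _ _ _ _ _ _ (pre _ _ _ b fg)).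
    by apply: rst_sym; apply: (pre _ _ _ a fg).
  by move: ab'; congr connected; apply: smap_eq.
exists (sexp_pre Z g 0 y).
by have := pre _ _ _ y gf; congr connected; apply: smap_eq.
Qed.

Section RestrictToFiber.
Variables (S : sset) (M X : over S) (s : S 0).

Lemma restrict_fiber n (y : map_over M X n) m (z : sprod (Delta n) (fiber (str M) s) m) :
  in_fiber (str X) s (sval y m (z.1, sval z.2)).
Proof. by rewrite /in_fiber map_overP; apply: (svalP z.2). Qed.

Lemma restrict_fiber_nat1 n (y : map_over M X n) l m (a : mono l m)
    (z : sprod (Delta n) (fiber (str M) s) m) :
  exist _ _ (restrict_fiber y (pull a z)) =
  pull a (exist _ _ (restrict_fiber y z) : fiber (str X) s m).
Proof. by apply: sig_eq; rewrite /= -smap_nat. Qed.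

Definition restrict_fiber_smap n (y : map_over M X n) :
    sexp (fiber (str M) s) (fiber (str X) s) n :=
  @SMap _ (fiber (str X) s) (fun m z => exist _ _ (restrict_fiber y z))
    (restrict_fiber_nat1 y).

Lemma restrict_fiber_nat m n (a : mono m n) (y : map_over M X n) :
  restrict_fiber_smap (pull a y) = pull a (restrict_fiber_smap y).
Proof. by apply: smap_eq => l [b z]; apply: sig_eq. Qed.

Definition restrict_to_fiber :
    smap (map_over M X) (sexp (fiber (str M) s) (fiber (str X) s)) :=
  SMap restrict_fiber_nat.
End RestrictToFiber.

Section Postcompose.
Variables (S : sset) (M X Y : over S) (f : over_map X Y).

Lemma map_over_post_fiber n (y : map_over M X n) :
  in_fiber (sexp_post M (str Y)) (name (str M)) (scomp f (sval y)).
Proof.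
apply: smap_eq => m [a x].
by rewrite /= over_commE map_overP.
Qed.

Lemma map_over_post_nat m n (a : mono m n) (y : map_over M X n) :
  exist _ _ (map_over_post_fiber (pull a y)) =
  pull a (exist _ _ (map_over_post_fiber y) : map_over M Y n).
Proof. by apply: sig_eq; apply: smap_eq. Qed.

Definition map_over_post : smap (map_over M X) (map_over M Y) :=
  @SMap _ (map_over M Y) (fun n y => exist _ _ (map_over_post_fiber y)) map_over_post_nat.
End Postcompose.

Section VertexOfMapOver.
Variables (S : sset) (M X : over S).

Lemma over_name_fiber (phi : over_map M X) :
  in_fiber (sexp_post M (str X)) (name (str M)) (name phi).
Proof. by apply: smap_eq => m [a x]; rewrite /= over_commE. Qed.

Definition over_name (phi : over_map M X) : map_over M X 0 :=
  exist _ _ (over_name_fiber phi).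

Lemma over_unname_comm (w : map_over M X 0) : scomp (str X) (unname (sval w)) = str M.
Proof. by apply: smap_eq => n x; rewrite /= map_overP. Qed.

Definition over_unname (w : map_over M X 0) : over_map M X :=
  OverMap (over_unname_comm w).
End VertexOfMapOver.

Lemma over_id_comm (S : sset) (X : over S) : scomp (str X) (sid X) = str X.
Proof. exact: smap_eq. Qed.

Definition over_id (S : sset) (X : over S) : over_map X X := OverMap (over_id_comm X).

(** * The two implications *)

Lemma bivariant_equivalence_pointwise (A B : sset) (X Y : over (sprod A B))
    (f : over_map X Y) :
  bifibration (str X) -> bifibration (str Y) ->
  bivariant_equivalence f -> pointwise_weak_homotopy_equivalence f.
Proof.
move=> hX hY hf a b; set s := (a, b).
have [q [_ qX]] := hf X hX; have [r [rY _]] := hf Y hY.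
(* The inverse of precomposition with [f] sends the identity of [X] to a vertex [g], and [g f] lies
   in the component of the identity. *)
pose w := q 0 (over_name (over_id X)); pose g := over_unname w.
have gf : connected (map_over_pre f X 0 w) (over_name (over_id X)).
  exact: homotopic_app (over_name (over_id X)) qX.
(* [f g f] and [f] lie in one component, and precomposition with [f] is injective on components
   because it has the left inverse [r] up to homotopy. *)
have fg : connected (map_over_post Y f 0 w) (over_name (over_id Y)).
  have inj (x y : map_over Y Y 0) :
      connected (map_over_pre f Y 0 x) (map_over_pre f Y 0 y) -> connected x y.
    move=> /(connected_map r) xy.
    apply: rst_trans (homotopic_app y rY).
    by apply: rst_trans xy; apply: rst_sym; apply: homotopic_app rY.
  apply: inj; have := connected_map (map_over_post X f) gf.
  by congr connected; apply: sig_eq; apply: smap_eq.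
apply: (@homotopy_inverse_whe _ _ _ (fiber_over_map g s)).
  have := connected_map (restrict_to_fiber X X s) gf.
  rewrite /homotopic; congr connected; apply: smap_eq => n [c z]; apply: sig_eq => //=.
  by congr (sval w n (_, _)); apply: mono_eq => i; rewrite !ord1.
have := connected_map (restrict_to_fiber Y Y s) fg.
rewrite /homotopic; congr connected; apply: smap_eq => n [c z]; apply: sig_eq => //=.
by congr (f n (sval w n (_, _))); apply: mono_eq => i; rewrite !ord1.
Qed.

Lemma pointwise_bivariant_equivalence (A B : sset) (X Y : over (sprod A B))
    (f : over_map X Y) :
  bifibration (str X) -> bifibration (str Y) ->
  pointwise_weak_homotopy_equivalence f -> bivariant_equivalence f.
Proof.
move=> hX hY hf Z _; have [g [gf fg]] := pointwise_homotopy_inverse hX hY hf.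
exists (map_over_pre g Z); split.
  by apply: (over_homotopic_id_pre _ fg).
by apply: (over_homotopic_id_pre _ gf).
Qed.

Theorem theorem4p27 (A B : sset) (X Y : over (sprod A B))
    (hX : bifibration (str X)) (hY : bifibration (str Y)) (f : over_map X Y) :
  bivariant_equivalence f <-> pointwise_weak_homotopy_equivalence f.
Proof.
split; first exact: bivariant_equivalence_pointwise.
exact: pointwise_bivariant_equivalence.
Qed.
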